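(* Let $X=S^1$, let $\mathcal M$ be the set of monotone Möbius structures on $X$ and $\mathcal T$ the set of timed causal spaces on $X$. With the constructions described in the context: (i) for every $M\in\mathcal M$ the triple $\widehat T(M)=(\mathrm{aY},\mathcal H_M,t_M)$ is a well defined element of $\mathcal T$; (ii) for every $T=(\mathrm{aY},\mathcal H,t)\in\mathcal T$ there is exactly one Möbius structure $\widehat M(T)$ on $X$ such that, for every 4-tuple $(x,y,z,u)$ of pairwise distinct points of $X$ for which the pairs $(x,u)$ and $(y,z)$ separate each other, and for every $d\in\widehat M(T)$, $$\ln\frac{d(x,z)\,d(y,u)}{d(x,u)\,d(y,z)}=-t(z_a,u_a),\qquad \ln\frac{d(x,u)\,d(y,z)}{d(x,y)\,d(z,u)}=t(x_b,z_b),$$ where $a=(x,y)$, $b=(y,u)\in\mathrm{aY}$; moreover $\widehat M(T)\in\mathcal M$; (iii) the maps $\widehat T:\mathcal M\to\mathcal T$ and $\widehat M:\mathcal T\to\mathcal M$ are mutually inverse; (iv) for every $M\in\mathcal M$ and $T=\widehat T(M)$, the assignment $g\mapsto\widehat g$, $\widehat g((x,y))=(g(x),g(y))$, is an isomorphism from the group of automorphisms of $M$ onto the group of automorphisms of $T$.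
   Context: **Events.** $X=S^1$. $\mathrm{aY}$ is the set of unordered pairs $(x,y)=(y,x)$ of distinct points of $X$ (called events); an event is also regarded as a two-point subset of $X$. Two events separate each other if they are disjoint as subsets and the points of one lie in different components of the complement in $X$ of the other. Two events are in the causal relation if they do not separate each other. The light line of $x\in X$ is $p_x=\{(x,x'):x'\in X\setminus\{x\}\}$. Two events are in the strong causal relation if they are in the causal relation and do not lie on a common light line. For an event $e$, let $e^+,e^-$ be the two closed arcs of $X$ with end points $e$ (labelled in either way), and $C_e^\pm=\{a\in\mathrm{aY}:a\subset e^\pm\}$. For events $e,e',e''$ we write $e\le e'\le e''$ if for a suitable labelling of the arcs of $e'$ we have $e\in C^-_{e'}$ and $e''\in C^+_{e'}$. **Timed causal space.** A triple $T=(\mathrm{aY},\mathcal H,t)$ where $\mathcal H$ is a collection of subsets of $\mathrm{aY}$ (timelike lines) satisfying: (h1) every event $e$ uniquely determines a timelike line $h_e\subset\mathrm{aY}$, and every timelike line is of the form $h_e$ for some event $e$; (h2) any $a\in h_e$ separates $e$; (h3) any two events on a timelike line are in the causal relation; (h4) for any $x\in X\setminus e$ there is a unique event $x_e=(x,y)\in h_e$ containing $x$; (h5) if $a\in h_e$ then $e\in h_a$; (h6) for any two distinct events $a,a'$ there is at most one timelike line $h_e$ with $a,a'\in h_e$; and $t$ (time) satisfies: (t1) $t(e,e')\ge0$ is defined if and only if $e,e'$ are in the causal relation; (t2) $t(e,e')=0$ iff $e,e'$ lie on a common light line; (t3) $t(e,e')=t(e',e)$ whenever defined; (t4) (a) if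 $e,e',e''\in h_a$ and $e\le e'\le e''$ then $t(e,e')+t(e',e'')=t(e,e'')$; (b) for every $e\in h_a$ and $s>0$ there are $e_\pm\in h_a\cap C_e^\pm$ with $t(e,e_\pm)=s$; (t5) for any $e=(x,y)$, $d=(z,u)$ in the strong causal relation, $t(z_e,u_e)=t(x_d,y_d)$; (t6) for any $e=(x,y)$ and $d=(z,u)\in h_e$, with $a=(x,z)$, $b=(x,u)$, we have $t(y_a,u_a)=t(y_b,z_b)$. An automorphism of $T$ is a bijection $g:\mathrm{aY}\to\mathrm{aY}$ mapping timelike lines to timelike lines (preserving $\mathcal H$) and preserving time: $t(g(e),g(e'))=t(e,e')$ whenever $t(e,e')$ is defined. **Möbius structures.** A semi-metric on $X$ is a symmetric function $d:X^2\to\mathbb R\cup\{\infty\}$, positive off the diagonal, zero on it, with at most one infinitely remote point $\omega$, i.e. a point with $d(x,\omega)=\infty$ for some (then, by requirement, for all) $x\ne\omega$. Two semi-metrics are Möbius equivalent if they have the same cross-ratios $\frac{d(x_1,x_3)d(x_2,x_4)}{d(x_1,x_4)d(x_2,x_3)}$ on all ordered 4-tuples of pairwise distinct points; here and in all homogeneous (in)equalities below, infinite distances to an infinitely remote point cancel. A Möbius structure is a Möbius equivalence class $M$ of semi-metrics. An automorphism of $M$ is a bijection $X\to X$ preserving all cross-ratios. The $M$-topology has as subbase all open balls, centered at finite points, of the semi-metrics in $M$ having an infinitely remote point. $M$ is monotone if (T) the $M$-topology is the usual topology of $S^1$, and (M) whenever the pairs $(x,y)$, $(z,u)$ separate each other,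 $|xy|\,|zu|>\max\{|xz|\,|yu|,\,|xu|\,|yz|\}$ for some (equivalently any) semi-metric $|\cdot\,\cdot|$ from $M$. **The construction $\widehat T(M)$.** For $e=(z,u)\in\mathrm{aY}$ let $h_e$ be the set of events $(x,y)$ such that $x,y,z,u$ are pairwise distinct and $|xz|\,|yu|=|xu|\,|yz|$ for some (any) semi-metric from $M$; $\mathcal H_M=\{h_e:e\in\mathrm{aY}\}$. Put $t_M(a,a')=0$ if $a,a'$ lie on a common light line. If $a=(z,u)$, $a'=(z',u')$ are in the strong causal relation, take the event $e=(x,y)$ with $a,a'\in h_e$ and put $t_M(a,a')=\left|\ln\frac{|xz'|\,|yz|}{|xz|\,|yz'|}\right|$. *)

(* Defs.v *)
From HB Require Import structures.
From mathcomp Require Import all_boot all_order all_algebra.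
From mathcomp Require Import all_classical all_reals all_analysis.

Set Implicit Arguments.
Unset Strict Implicit.
Unset Printing Implicit Defensive.

Import Order.TTheory GRing.Theory Num.Theory.
Import numFieldNormedType.Exports.

Local Open Scope classical_set_scope.
Local Open Scope ring_scope.

(* The circle, as a subtype of R * R with the induced topology. *)
Definition circle (R : realType) : set (R * R) :=
  [set p | p.1 ^+ 2 + p.2 ^+ 2 = 1].

Arguments circle R : clear implicits.

Notation S1 R := (set_type (circle R)).

Section Events.
Variable R : realType.
Implicit Types x y z u : S1 R.

Definition events : set (set (S1 R)) :=
  [set s | exists x y, x != y /\ s = [set x; y]].

Definition event := set_type events.

Definition pts (e : event) : set (S1 R) := val e.

Definition pair_of (e : event) x y : Prop := pts e = [set x; y].

Implicit Types e a b d : event.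

(* On the circle this relation is symmetric in e and a. *)
Definition separate e a : Prop :=
  pts e `&` pts a = set0 /\
  forall z u, pair_of a z u ->
    connected_component (~` pts e) z <> connected_component (~` pts e) u.

Definition causal e a : Prop := ~ separate e a.

Definition light_line x : set event :=
  [set e | exists2 x', x' != x & pair_of e x x'].

Definition on_light_line e a : Prop :=
  exists x, light_line x e /\ light_line x a.

Definition strong_causal e a : Prop := causal e a /\ ~ on_light_line e a.

(* The closed arcs with end points e are the closures of the components of the
   complement of e. *)
Definition is_arc e (A : set (S1 R)) : Prop :=
  exists2 x, ~ pts e x & A = closure (connected_component (~` pts e) x).

(* C_e^+ and C_e^-, where A is the arc e^+ or e^-. *)
Definition arc_cone (A : set (S1 R)) : set event := [set a | pts a `<=` A].

(* e <= e' <= e'' *)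
Definition between e e' e'' : Prop :=
  exists Am Ap, [/\ is_arc e' Am, is_arc e' Ap, Am <> Ap,
                    arc_cone Am e & arc_cone Ap e''].

(* The event x_e of the line h e which contains x; it exists and is unique when
   x is not in e and h satisfies (h4), the default value e is irrelevant. *)
Definition event_at (h : event -> set event) e x : event :=
  xget e [set a | h e a /\ pts a x].

End Events.

(* Time is a partial function: t e e' = None means that t(e, e') is undefined. *)
Record timed_causal_axioms (R : realType) (H : set (set (event R)))
    (t : event R -> event R -> option R) (h : event R -> set (event R)) : Prop := {
  tc_h1 : H = range h;
  tc_h2 : forall e a, h e a -> separate a e;
  tc_h3 : forall l a a', H l -> l a -> l a' -> causal a a';
  tc_h4 : forall e x, ~ pts e x -> exists! a, h e a /\ pts a x;
  tc_h5 : forall e a, h e a -> h a e;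
  tc_h6 : forall a a' l l', a != a' ->
    H l -> H l' -> l a -> l a' -> l' a -> l' a' -> l = l';
  tc_t1_def : forall e e', (exists s, t e e' = Some s) <-> causal e e';
  tc_t1_ge0 : forall e e' s, t e e' = Some s -> 0 <= s;
  tc_t2 : forall e e', t e e' = Some 0 <-> on_light_line e e';
  tc_t3 : forall e e', t e e' = t e' e;
  tc_t4a : forall a e e' e'' s s', h a e -> h a e' -> h a e'' ->
    between e e' e'' -> t e e' = Some s -> t e' e'' = Some s' ->
    t e e'' = Some (s + s');
  tc_t4b : forall a e s A, h a e -> 0 < s -> is_arc e A ->
    exists e', [/\ h a e', arc_cone A e' & t e e' = Some s];
  tc_t5 : forall e d x y z u, strong_causal e d -> pair_of e x y -> pair_of d z u ->
    t (event_at h e z) (event_at h e u) = t (event_at h d x) (event_at h d y);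
  tc_t6 : forall e d a b x y z u, h e d -> pair_of e x y -> pair_of d z u ->
    pair_of a x z -> pair_of b x u ->
    t (event_at h a y) (event_at h a u) = t (event_at h b y) (event_at h b z)
}.

(* The map e |-> h_e is determined by the set of timelike lines: by (h2) and
   (h4), the points of e are exactly those on no event of h_e. *)
Record timed_causal_space (R : realType) := TimedCausalSpace {
  lines : set (set (event R));
  time : event R -> event R -> option R;
  tcsP : exists h, timed_causal_axioms lines time h
}.

Definition line_of (R : realType) (T : timed_causal_space R) :
  event R -> set (event R) := sval (cid (tcsP T)).

Section Moebius.
Variable R : realType.

Definition inf_remote (d : S1 R -> S1 R -> \bar R) (w : S1 R) : Prop :=
  forall x, x != w -> d x w = +oo%E.

Record is_semimetric (d : S1 R -> S1 R -> \bar R) : Prop := {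
  sm_sym : forall x y, d x y = d y x;
  sm_diag : forall x, d x x = 0%E;
  sm_pos : forall x y, x != y -> (0 < d x y)%E;
  sm_inf : forall x y, d x y = +oo%E -> inf_remote d x \/ inf_remote d y;
  sm_inf_uniq : forall w w', inf_remote d w -> inf_remote d w' -> w = w'
}.

Record semimetric := Semimetric {
  sm_dist :> S1 R -> S1 R -> \bar R;
  sm_distP : is_semimetric sm_dist
}.

(* Infinite distances are replaced by 1. In the homogeneous expressions below
   every point occurs equally often on both sides of the fraction or of the
   (in)equality, so this amounts to cancelling the infinite distances. *)
Definition fdist (d : semimetric) (x y : S1 R) : R :=
  if d x y is r%:E then r else 1.

Definition cross_ratio (d : semimetric) (x1 x2 x3 x4 : S1 R) : R :=
  (fdist d x1 x3 * fdist d x2 x4) / (fdist d x1 x4 * fdist d x2 x3).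

Definition moebius_equiv (d d' : semimetric) : Prop :=
  forall x1 x2 x3 x4, uniq [:: x1; x2; x3; x4] ->
    cross_ratio d x1 x2 x3 x4 = cross_ratio d' x1 x2 x3 x4.

Record moebius := Moebius {
  moebius_class :> semimetric -> Prop;
  moebius_classP : exists d, moebius_class = moebius_equiv d
}.

Definition moebius_balls (M : moebius) : set (set (S1 R)) :=
  [set B | exists (d : semimetric) w x (r : R),
    [/\ M d, inf_remote d w, x != w, 0 < r & B = [set y | (d x y < r%:E)%E]]].

Definition moebius_open (M : moebius) : set (set (S1 R)) :=
  [set \bigcup_(B in D) B | D in [set D | D `<=` finI_from (moebius_balls M) id]].

Record is_monotone (M : moebius) : Prop := {
  monotone_T : moebius_open M = open;
  monotone_M : forall (d : semimetric) e a x y z u, M d ->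
    separate e a -> pair_of e x y -> pair_of a z u ->
    Num.max (fdist d x z * fdist d y u) (fdist d x u * fdist d y z)
      < fdist d x y * fdist d z u
}.

Record monotone_moebius := MonotoneMoebius {
  mm_moebius :> moebius;
  mm_monotone : is_monotone mm_moebius
}.

(* The line h_e computed with the semi-metric d. *)
Definition sm_line (d : semimetric) (e : event R) : set (event R) :=
  [set a | exists x y z u, [/\ pair_of a x y, pair_of e z u,
    uniq [:: x; y; z; u] &
    fdist d x z * fdist d y u = fdist d x u * fdist d y z]].

(* "t_M(a, a') is defined and equal to s", computed with the semi-metric d; e is
   the common perpendicular of a and a'. *)
Definition sm_time (d : semimetric) (a a' : event R) (s : R) : Prop :=
  (on_light_line a a' /\ s = 0) \/
  (strong_causal a a' /\
   exists e x y z u z' u', [/\ pair_of e x y, pair_of a z u, pair_of a' z' u',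
     sm_line d e a /\ sm_line d e a' &
     s = `|ln ((fdist d x z' * fdist d y z) / (fdist d x z * fdist d y z'))|]).

End Moebius.

(* T = (aY, H_M, t_M), whichever semi-metric d of M, common perpendicular and
   labelling of the events are used to compute lines and times. *)
Definition is_That (R : realType) (M : moebius R) (T : timed_causal_space R) : Prop :=
  forall d, M d ->
    [/\ line_of T = sm_line d,
        lines T = range (sm_line d) &
        forall a a' s, time T a a' = Some s <-> sm_time d a a' s].

Definition is_Mhat (R : realType) (T : timed_causal_space R) (M : moebius R) : Prop :=
  forall (x y z u : S1 R) (c c' a b : event R) (d : semimetric R), M d ->
    uniq [:: x; y; z; u] ->
    pair_of c x u -> pair_of c' y z -> separate c c' ->
    pair_of a x y -> pair_of b y u ->
    time T (event_at (line_of T) a z) (event_at (line_of T) a u) =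
      Some (- ln ((fdist d x z * fdist d y u) / (fdist d x u * fdist d y z))) /\
    time T (event_at (line_of T) b x) (event_at (line_of T) b z) =
      Some (ln ((fdist d x u * fdist d y z) / (fdist d x y * fdist d z u))).

Definition moebius_aut (R : realType) (M : moebius R) : set (S1 R -> S1 R) :=
  [set g | bijective g /\
    forall (d : semimetric R) x1 x2 x3 x4, M d -> uniq [:: x1; x2; x3; x4] ->
      cross_ratio d (g x1) (g x2) (g x3) (g x4) = cross_ratio d x1 x2 x3 x4].

Definition tcs_aut (R : realType) (T : timed_causal_space R) :
    set (event R -> event R) :=
  [set g | [/\ bijective g,
    forall l, lines T l -> lines T (g @` l) &
    forall e e' s, time T e e' = Some s -> time T (g e) (g e') = Some s]].

(* The event (g x, g y), for e = (x, y); the default value e is only used when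
   g identifies the points of e. *)
Definition event_map (R : realType) (g : S1 R -> S1 R) (e : event R) : event R :=
  xget e [set e' | pts e' = g @` pts e].

Definition transformation_group (X : Type) (G : set (X -> X)) : Prop :=
  [/\ G id, forall f g, G f -> G g -> G (f \o g) &
      forall f, G f -> exists g, [/\ G g, cancel f g & cancel g f]].

(* Main.v *)
(* Write G = ln d. A Moebius structure is a symmetric G up to G(x,y) + l(x) + l(y),
   and (M) says that for x, y, z, u in cyclic order G(x,z) + G(y,u) exceeds both
   G(x,y) + G(z,u) and G(y,z) + G(x,u). Given (M), axiom (T) is equivalent to: for
   p <> w the function G(p,.) - G(w,.) maps the arc from p to w onto R (balls are
   open and the arc is connected, so no value is skipped; conversely balls are
   arcs).

   From M to T. The involution x |-> x' with (x,x') on h_(p,w) is determined by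
   equality of G(p,.) - G(w,.), hence reverses the cyclic order. Two disjoint
   non-separating events have a common perpendicular because the composition of
   their involutions is an increasing self-map of a closed arc; it is unique
   because the distance between the two events along the outer of two common
   perpendiculars would be both smaller and larger than along the inner one.

   From T to M. Let mu(a,b,c,e) be the time on the line of (a,b) between the events
   through c and e. By (t4) and (t5), mu is a symmetric additive function of pairs
   of disjoint arcs, and it has to be G(a,c) + G(b,e) - G(b,c) - G(a,e). Fix w; time
   gives each line h_(x,w) a coordinate, which extended to the circle is a function
   phi_x, the desired G(x,.) up to a constant c_x. The constants can be chosen to
   make G symmetric because
     phi_x(y) - phi_x(p) + phi_p(x) - phi_p(y) + phi_y(p) - phi_y(x) = 0,
   which is (t6) when (x,p) is on h_(y,w) and follows by additivity in general.

   Automorphisms of T preserve time 0, i.e. intersection of events, so they permute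
   the light lines and are induced by a bijection of the circle. It preserves
   absolute values of logarithms of cross-ratios, and their signs because it
   preserves the non-separating pairs among the three pairings of four points. *)
Require Import Defs.
From mathcomp Require Import all_boot all_order all_algebra.
From mathcomp Require Import all_classical all_reals all_analysis.
From mathcomp Require Import lra.

Set Implicit Arguments.
Unset Strict Implicit.
Unset Printing Implicit Defensive.

Import Order.TTheory GRing.Theory Num.Theory.
Import numFieldNormedType.Exports.

Local Open Scope classical_set_scope.
Local Open Scope ring_scope.

(** * Stereographic coordinates and the cyclic order of the circle *)

Section Circle.
Variable R : realType.
Implicit Types p q r w : S1 R.

Definition xco p : R := (val p).1.
Definition yco p : R := (val p).2.

(** Twice the signed area of the triangle [p q r]; for points of the circle its positivity is the
    counterclockwise order. *)
Definition orient p q r : R :=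
  (xco q - xco p) * (yco r - yco p) -
  (yco q - yco p) * (xco r - xco p).

Definition cyc p q r : bool := 0 < orient p q r.

(* Inverse of the stereographic projection from w, oriented so that it is
   increasing counterclockwise. *)
Definition unstereo_pt w (s : R) : R * R :=
  (((s ^+ 2 - 1) * xco w + 2 * s * yco w) / (s ^+ 2 + 1),
   ((s ^+ 2 - 1) * yco w - 2 * s * xco w) / (s ^+ 2 + 1)).

Lemma circleP p : xco p ^+ 2 + yco p ^+ 2 = 1.
Proof. exact: (set_valP p). Qed.

Lemma S1_eq p q : xco p = xco q -> yco p = yco q -> p = q.
Proof.
move=> e1 e2; apply: val_inj.
by rewrite [LHS]surjective_pairing [RHS]surjective_pairing; congr pair.
Qed.

Lemma sqrD1_gt0 (s : R) : 0 < s ^+ 2 + 1.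
Proof. by rewrite ltr_wpDl ?sqr_ge0. Qed.

Lemma sqrD1_neq0 (s : R) : s ^+ 2 + 1 != 0.
Proof. by rewrite lt0r_neq0 ?sqrD1_gt0. Qed.

Lemma unstereo_subproof w s : unstereo_pt w s \in circle R.
Proof.
rewrite inE /circle /=; have := circleP w; have s0 := sqrD1_neq0 s.
move: (xco w) (yco w) => a b ab; rewrite !expr_div_n -mulrDl.
apply: (canLR (mulfK _)); first by rewrite expf_neq0.
rewrite mul1r.
have -> : ((s ^+ 2 - 1) * a + 2 * s * b) ^+ 2 +
          ((s ^+ 2 - 1) * b - 2 * s * a) ^+ 2 =
          (s ^+ 2 + 1) ^+ 2 * (a ^+ 2 + b ^+ 2) by lra.
by rewrite ab mulr1.
Qed.

Definition unstereo w s : S1 R :=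
  exist (fun v => v \in circle R) _ (unstereo_subproof w s).

Lemma unstereo1 w s : (s ^+ 2 + 1) * xco (unstereo w s) =
  (s ^+ 2 - 1) * xco w + 2 * s * yco w.
Proof. by rewrite /xco /yco /= mulrCA mulfV ?mulr1 // sqrD1_neq0. Qed.

Lemma unstereo2 w s : (s ^+ 2 + 1) * yco (unstereo w s) =
  (s ^+ 2 - 1) * yco w - 2 * s * xco w.
Proof. by rewrite /xco /yco /= mulrCA mulfV ?mulr1 // sqrD1_neq0. Qed.

Lemma one_sub_dot_gt0 w p : p != w ->
  0 < 1 - xco w * xco p - yco w * yco p.
Proof.
move=> pw.
have -> : 1 - xco w * xco p - yco w * yco p =
  ((xco w - xco p) ^+ 2 + (yco w - yco p) ^+ 2) / 2.
  by have := circleP p; have := circleP w; lra.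
rewrite divr_gt0// lt0r addr_ge0 ?sqr_ge0// andbT.
apply: contra_neq pw => /eqP; rewrite paddr_eq0 ?sqr_ge0// !sqrf_eq0 !subr_eq0.
by move=> /andP[/eqP e1 /eqP e2]; apply: S1_eq.
Qed.

Lemma unstereo_surj w p : p != w -> exists s, p = unstereo w s.
Proof.
move=> /one_sub_dot_gt0; have := circleP p; have := circleP w.
set a := xco w; set b := yco w; set c := xco p; set d := yco p.
(* In the orthonormal frame [(a, b)], [(b, -a)] the point [p] has the coordinates [1 - D] and [N].
   Comparison with [unstereo_pt] gives [2 / (s ^+ 2 + 1) = D], hence [s = N / D]. *)
set D := 1 - a * c - b * d => hw hp D0; pose N := b * c - a * d.
have ND : N ^+ 2 = 2 * D - D ^+ 2.
  have : (b * c - a * d) ^+ 2 + (a * c + b * d) ^+ 2 =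
         (a ^+ 2 + b ^+ 2) * (c ^+ 2 + d ^+ 2) by lra.
  by rewrite hw hp /N /D; lra.
have e1 : c = (1 - D) * a + N * b.
  have : c = (a ^+ 2 + b ^+ 2) * c by rewrite hw mul1r.
  by rewrite /N /D; lra.
have e2 : d = (1 - D) * b - N * a.
  have : d = (a ^+ 2 + b ^+ 2) * d by rewrite hw mul1r.
  by rewrite /N /D; lra.
have D1 : D != 0 by rewrite lt0r_neq0.
have sE : (N / D) ^+ 2 = 2 / D - 1.
  rewrite expr_div_n ND mulrBl expr2 mulfV ?mulf_neq0//; congr (_ - _).
  by rewrite invfM mulrA mulfK.
exists (N / D); apply: S1_eq; apply: (mulfI (sqrD1_neq0 (N / D))).
  rewrite unstereo1 sE -/a -/b -/c e1.
  have : D / D = 1 by rewrite mulfV.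
  move: (D^-1) => i Di.
  have : D * i * a = a by rewrite Di mul1r.
  lra.
rewrite unstereo2 sE -/a -/b -/d e2.
have : D / D = 1 by rewrite mulfV.
move: (D^-1) => i Di.
have : D * i * b = b by rewrite Di mul1r.
lra.
Qed.

(** After multiplication by the three positive denominators the signed area becomes four times the
    Vandermonde product of the coordinates. *)
Lemma unstereo_orient w x y z :
  0 < orient (unstereo w x) (unstereo w y) (unstereo w z) =
  (0 < (y - x) * (z - y) * (z - x)).
Proof.
have hw := circleP w.
have [X0 Y0 Z0] := And3 (sqrD1_gt0 x) (sqrD1_gt0 y) (sqrD1_gt0 z).
have := And3 (unstereo1 w x) (unstereo1 w y) (unstereo1 w z).
have := And3 (unstereo2 w x) (unstereo2 w y) (unstereo2 w z).
rewrite /orient; move: (xco (unstereo w x)) (xco (unstereo w y)) (xco (unstereo w z)) (xco w) hw.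
move: (yco (unstereo w x)) (yco (unstereo w y)) (yco (unstereo w z)) (yco w).
move=> p2 q2 r2 b p1 q1 r1 a hw [ex2 ey2 ez2] [ex1 ey1 ez1].
have e : (x ^+ 2 + 1) * (y ^+ 2 + 1) * (z ^+ 2 + 1) *
  ((q1 - p1) * (r2 - p2) - (q2 - p2) * (r1 - p1)) =
  4 * ((y - x) * (z - y) * (z - x)).
  pose X := x ^+ 2 + 1; pose Y := y ^+ 2 + 1; pose Z := z ^+ 2 + 1.
  have -> : X * Y * Z * ((q1 - p1) * (r2 - p2) - (q2 - p2) * (r1 - p1)) =
   X * ((Y * q1) * (Z * r2) - (Y * q2) * (Z * r1)) -
   Z * ((Y * q1) * (X * p2) - (Y * q2) * (X * p1)) -
   Y * ((X * p1) * (Z * r2) - (X * p2) * (Z * r1)) by lra.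
  rewrite /X /Y /Z ex1 ex2 ey1 ey2 ez1 ez2.
  transitivity (4 * ((y - x) * (z - y) * (z - x)) * (a ^+ 2 + b ^+ 2)).
    lra.
  by rewrite hw mulr1.
have XYZ : 0 < (x ^+ 2 + 1) * (y ^+ 2 + 1) * (z ^+ 2 + 1) by rewrite !mulr_gt0.
by rewrite -(pmulr_rgt0 _ XYZ) e pmulr_rgt0.
Qed.

Lemma base_orient w x y : 0 < orient w (unstereo w x) (unstereo w y) = (x < y).
Proof.
have hw := circleP w.
have [X0 Y0] := conj (sqrD1_gt0 x) (sqrD1_gt0 y).
have := conj (unstereo1 w x) (unstereo1 w y).
have := conj (unstereo2 w x) (unstereo2 w y).
rewrite /orient; move: (xco (unstereo w x)) (xco (unstereo w y)) (xco w) hw.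
move: (yco (unstereo w x)) (yco (unstereo w y)) (yco w).
move=> p2 q2 b p1 q1 a hw [ex2 ey2] [ex1 ey1].
have e : (x ^+ 2 + 1) * (y ^+ 2 + 1) *
  ((p1 - a) * (q2 - b) - (p2 - b) * (q1 - a)) = 4 * (y - x).
  pose X := x ^+ 2 + 1; pose Y := y ^+ 2 + 1.
  have -> : X * Y * ((p1 - a) * (q2 - b) - (p2 - b) * (q1 - a)) =
   (X * p1 - X * a) * (Y * q2 - Y * b) - (X * p2 - X * b) * (Y * q1 - Y * a) by lra.
  rewrite /X /Y ex1 ex2 ey1 ey2.
  transitivity (4 * (y - x) * (a ^+ 2 + b ^+ 2)); first by lra.
  by rewrite hw mulr1.
have XY : 0 < (x ^+ 2 + 1) * (y ^+ 2 + 1) by rewrite !mulr_gt0.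
by rewrite -(pmulr_rgt0 _ XY) e pmulr_rgt0// subr_gt0.
Qed.

Lemma cyc_rot p q r : cyc p q r = cyc q r p.
Proof. by rewrite /cyc /orient; congr (0 < _); lra. Qed.

Lemma cycxxy p q : cyc p p q = false.
Proof. by rewrite /cyc /orient !subrr !mul0r subrr ltxx. Qed.

Lemma cycxyy p q : cyc p q q = false.
Proof. by rewrite cyc_rot cycxxy. Qed.

Lemma cycxyx p q : cyc p q p = false.
Proof. by rewrite cyc_rot cycxyy. Qed.

Lemma cyc_base1 w x y : cyc w (unstereo w x) (unstereo w y) = (x < y).
Proof. exact: base_orient. Qed.

Lemma unstereo_base w s : w == unstereo w s = false.
Proof.
apply/negP => /eqP e; have : cyc w (unstereo w s) (unstereo w (s + 1)).
  by rewrite cyc_base1 ltrDl.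
by rewrite -e cycxxy.
Qed.

Lemma base_unstereo w s : unstereo w s == w = false.
Proof. by rewrite eq_sym unstereo_base. Qed.

Lemma unstereo_inj w : injective (unstereo w).
Proof.
move=> x y e; have := cyc_base1 w x y; have := cyc_base1 w y x.
by rewrite e !cycxyy; case: ltgtP.
Qed.

Lemma eq_unstereo w x y : unstereo w x == unstereo w y = (x == y).
Proof. exact/inj_eq/unstereo_inj. Qed.

Lemma cyc_base2 w x y : cyc (unstereo w y) w (unstereo w x) = (x < y).
Proof. by rewrite cyc_rot cyc_base1. Qed.

Lemma cyc_base3 w x y : cyc (unstereo w x) (unstereo w y) w = (x < y).
Proof. by rewrite -cyc_rot cyc_base1. Qed.

Lemma cyc_unstereo w x y z : cyc (unstereo w x) (unstereo w y) (unstereo w z) =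
  [|| (x < y) && (y < z), (y < z) && (z < x) | (z < x) && (x < y)].
Proof.
rewrite /cyc unstereo_orient.
case: (ltgtP x y) => [xy|xy|->]; last by rewrite subrr !mul0r !ltxx andbF; case: ltgtP.
  rewrite -mulrA pmulr_rgt0 ?subr_gt0//.
  case: (ltgtP y z) => [yz|yz|<-]; last by rewrite subrr mul0r ltxx; case: ltgtP xy.
    by rewrite pmulr_rgt0 ?subr_gt0// (lt_trans xy yz).
  by rewrite nmulr_rgt0 ?subr_lt0//; apply/idP/idP; lra.
rewrite -mulrA nmulr_rgt0 ?subr_lt0//=.
case: (ltgtP y z) => [yz|yz|<-]; last by rewrite subrr mul0r ltxx andbF.
  by rewrite pmulr_rlt0 ?subr_gt0//; apply/idP/idP; lra.
by rewrite nmulr_rlt0 ?subr_lt0//; apply/idP/idP; lra.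
Qed.

(** The view of the circle as a real line with [w] as point at infinity; it turns statements about
    [cyc] into linear inequalities. *)
Variant unstereo_spec w : S1 R -> Prop :=
  | UnstereoBase : unstereo_spec w w
  | UnstereoPt s : unstereo_spec w (unstereo w s).

Lemma unstereoP w p : unstereo_spec w p.
Proof.
have [->|/unstereo_surj[s ->]] := eqVneq p w; [exact: UnstereoBase|exact: UnstereoPt].
Qed.

End Circle.

Definition cycE := (cyc_unstereo, cyc_base1, cyc_base2, cyc_base3, cycxxy, cycxyy,
  cycxyx, eq_unstereo, base_unstereo, unstereo_base, eqxx).

Definition cyc4 (R : realType) (p q r s : S1 R) : bool := cyc p q r && cyc p r s.

Ltac stereo p q := case: (unstereoP p q) => [|?].
(* Decides a statement about the cyclic order of the point p and the other given
   points, in the stereographic coordinate from p. *)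
Ltac cyc_done := rewrite /cyc4 ?cycE //=; lra.
Tactic Notation "cyc" constr(p) constr(q) := stereo p q; cyc_done.
Tactic Notation "cyc" constr(p) constr(q) constr(r) :=
  stereo p q; stereo p r; cyc_done.
Tactic Notation "cyc" constr(p) constr(q) constr(r) constr(s) :=
  stereo p q; stereo p r; stereo p s; cyc_done.
Tactic Notation "cyc" constr(p) constr(q) constr(r) constr(s) constr(t) :=
  stereo p q; stereo p r; stereo p s; stereo p t; cyc_done.
Tactic Notation "cyc" constr(p) constr(q) constr(r) constr(s) constr(t) constr(u) :=
  stereo p q; stereo p r; stereo p s; stereo p t; stereo p u; cyc_done.

Section CyclicOrder.
Variable R : realType.
Implicit Types p q r s t w : S1 R.

Lemma cyc_asym p q r : cyc p q r -> ~~ cyc p r q.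
Proof. cyc p q r. Qed.

Lemma cyc_neq p q r : cyc p q r -> [&& p != q, q != r & p != r].
Proof. cyc p q r. Qed.

Lemma uniq4 p q r s : uniq [:: p; q; r; s] =
  [&& p != q, p != r, p != s, q != r, q != s & r != s].
Proof. by rewrite /= !inE !negb_or andbT -!andbA. Qed.

Lemma cyc4_neq p q r s : cyc4 p q r s ->
  [&& p != q, p != r, p != s, q != r, q != s & r != s].
Proof. by cyc p q r s. Qed.

Lemma cyc4_rot p q r s : cyc4 p q r s = cyc4 q r s p.
Proof. by apply/idP/idP; cyc p q r s. Qed.

End CyclicOrder.

(** * Open arcs: base of the topology, connectedness, components and closures *)

Section CircleTopology.
Variable R : realType.
Implicit Types p q r s w : S1 R.

Definition arc p q : set (S1 R) := [set r | cyc p r q].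

Lemma unstereo_continuous w : continuous (unstereo w).
Proof.
apply: (@continuous_comp_initial _ _ _ set_val (unstereo w)) => s.
have ds : (t ^+ 2 + 1)^-1 @[t --> s] --> (s ^+ 2 + 1)^-1.
  by apply: cvgV; [exact: sqrD1_neq0|apply: cvgD; [exact: exprn_continuous|exact: cvg_cst]].
have ns : t ^+ 2 - 1 @[t --> s] --> s ^+ 2 - 1.
  by apply: cvgB; [exact: exprn_continuous|exact: cvg_cst].
have ms : 2 * t @[t --> s] --> 2 * s by apply: cvgM; [exact: cvg_cst|exact: cvg_id].
suff : unstereo_pt w t @[t --> s] --> unstereo_pt w s by [].
apply: (@cvg_pair _ _ _ (nbhs s) (nbhs (unstereo_pt w s).1)
  (nbhs (unstereo_pt w s).2)); apply: cvgM => //.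
  by apply: cvgD; (apply: cvgM; [|exact: cvg_cst]).
by apply: cvgB; (apply: cvgM; [|exact: cvg_cst]).
Qed.

Lemma S1_val_continuous : continuous (fun p : S1 R => set_val p).
Proof. exact: initial_continuous. Qed.

Lemma orient_cvg p q r (F : set_system (S1 R)) : Filter F ->
  xco t @[t --> F] --> xco r -> yco t @[t --> F] --> yco r ->
  orient p t q @[t --> F] --> orient p r q.
Proof.
move=> FF xc yc; rewrite /orient; apply: cvgB.
  by apply: cvgM; [apply: cvgB; [exact: xc|exact: cvg_cst]|exact: cvg_cst].
by apply: cvgM; [apply: cvgB; [exact: yc|exact: cvg_cst]|exact: cvg_cst].
Qed.

Lemma orient_continuous p q : continuous (fun r => orient p r q).
Proof.
move=> r; have vc := @S1_val_continuous r.
have fc : fst @ nbhs (set_val r : R * R) --> nbhs (xco r) by exact: cvg_fst.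
have sc : snd @ nbhs (set_val r : R * R) --> nbhs (yco r) by exact: cvg_snd.
have xc : xco t @[t --> r] --> xco r by exact: cvg_comp vc fc.
have yc : yco t @[t --> r] --> yco r by exact: cvg_comp vc sc.
exact: (@orient_cvg p q r (nbhs r) (nbhs_filter r) xc yc).
Qed.

Lemma arc_open p q : open (arc p q).
Proof.
have -> : arc p q = (fun r => orient p r q) @^-1` [set x | 0 < x] by [].
by apply: open_comp; [move=> r _; exact: orient_continuous|exact: open_gt].
Qed.

(** Projected from a point other than [p], the set [U] becomes a neighbourhood of a real number; the
    end points of an interval in it give [a] and [b]. *)
Lemma open_arc (U : set (S1 R)) p : open U -> U p ->
  exists a b, cyc a p b /\ arc a b `<=` U.
Proof.
move=> oU; set w := unstereo p 0.
have : p != w by rewrite unstereo_base.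
move=> /unstereo_surj[s ->] Us.
have oV : open (unstereo w @^-1` U).
  by apply: open_comp => // t _; exact: unstereo_continuous.
have [e /= e0 se] : nbhs_ball s (unstereo w @^-1` U).
  by apply/nbhs_ballP; exact: open_nbhs_nbhs.
exists (unstereo w (s - e)), (unstereo w (s + e)); split.
  by rewrite cycE; lra.
move=> r; rewrite /arc /=; case: (unstereoP w r) => [|t]; first by rewrite cycE; lra.
move=> h; apply: se; rewrite /ball /= ltr_norml; move: h; rewrite cycE; lra.
Qed.

(** Projected from its own starting point, a nonempty arc is an open half-line. *)
Lemma arc_connected p q : connected (arc p q).
Proof.
case: (unstereoP p q) => [|y].
  have -> : arc p p = set0 by apply/seteqP; split=> // r; rewrite /arc /= cycxyx.
  exact: connected0.
have -> : arc p (unstereo p y) = unstereo p @` [set x | x < y].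
  apply/seteqP; split => [r|_ [x xy <-]]; rewrite /arc /= ?cycE//.
  by case: (unstereoP p r) => [|x]; rewrite cycE// => xy; exists x.
apply: connected_continuous_connected; last first.
  by apply: continuous_subspaceT; exact: unstereo_continuous.
by apply/connected_intervalP => a b /= ay bb c /andP[ac cb]; apply: le_lt_trans bb.
Qed.

Lemma arcC p q r : p != q -> r != p -> r != q -> ~~ cyc p r q = cyc q r p.
Proof.
case: (unstereoP p q) => [|?]; case: (unstereoP p r) => [|?]; rewrite ?cycE //=.
by move=> _ _ h; apply/idP/idP; lra.
Qed.

Lemma closure_arc_sub p q : closure (arc p q) `<=` ~` arc q p.
Proof.
have : closed (~` arc q p) by apply: open_closedC; exact: arc_open.
move=> /closure_id ->; apply: closureS => r; rewrite /arc /=.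
by move=> h1 h2; move: h1 h2; cyc p q r.
Qed.

Lemma arc_separated p q : separated (arc p q) (arc q p).
Proof.
by split; rewrite -subset0 => r [h1 h2];
  [exact: (closure_arc_sub h1)|exact: (closure_arc_sub h2)].
Qed.

(** The arc is connected, so the component contains it. Conversely the component is connected and
    covered by the two separated arcs, so it stays in the one that contains [r]. *)
Lemma component_arc p q r : cyc p r q ->
  connected_component (~` [set p; q]) r = arc p q.
Proof.
move=> prq; apply/seteqP; split; last first.
  apply: connected_component_max => //; last exact: arc_connected.
  by move=> s + [] e; rewrite /arc /= e (cycxxy, cycxyy).
have npq : p != q by apply: contraTneq prq => ->; rewrite cycxyx.
have cover : connected_component (~` [set p; q]) r `<=` arc p q `|` arc q p.
  move=> s /connected_component_sub /= /not_orP[/eqP sp /eqP sq].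
  by case: (boolP (cyc p s q)) => [|h]; [left|right; rewrite /arc /= -arcC].
have rC : connected_component (~` [set p; q]) r r.
  by apply: connected_component_refl => -[] e; move: prq; rewrite e (cycxxy, cycxyy).
have [|h] := connected_subset (arc_separated p q) cover (@component_connected _ _ _); first by [].

by have hr : cyc q r p := h _ rC; move: prq hr; clear; cyc p q r.
Qed.

(** Describing a closed arc as the complement of the opposite open arc reduces membership in it to
    [cyc]. *)
Lemma closure_arc p q : p != q -> closure (arc p q) = ~` arc q p.
Proof.
move=> npq; apply/seteqP; split; first exact: closure_arc_sub.
move=> r /= rqp; have [->|rp] := eqVneq r p.
  move=> U; rewrite nbhsE => -[V [oV Vp] VU].
  have [a [b [apb abV]]] := open_arc oV Vp.
  (* In the coordinate from [p], a number below the coordinates of both [b] and [q]: such a point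
     follows [p] closely enough to lie in [V] and in the arc. *)
  have [s pss] : exists s, cyc p s b && cyc p s q.
    case: (unstereoP p b) apb => [|x]; first by rewrite cycxyy.
    case: (unstereoP p q) npq => [|y]; first by rewrite eqxx.
    by move=> _ _; case: (leP x y) => ?; [exists (unstereo p (x - 1))|
      exists (unstereo p (y - 1))]; rewrite !cycE; lra.
  exists s; split; first by case/andP: pss.
  apply/VU/abV; rewrite /arc /=; move: apb pss; clear; cyc p a b s q.
have [->|rq] := eqVneq r q.
  move=> U; rewrite nbhsE => -[V [oV Vq] VU].
  have [a [b [aqb abV]]] := open_arc oV Vq.
  have [s pss] : exists s, cyc q a s && cyc p s q.
    case: (unstereoP q a) aqb => [|x]; first by rewrite cycxxy.
    case: (unstereoP q p) npq => [|y]; first by rewrite eqxx.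
    by move=> _ _; case: (leP x y) => ?; [exists (unstereo q (y + 1))|
      exists (unstereo q (x + 1))]; rewrite !cycE; lra.
  exists s; split; first by case/andP: pss.
  apply/VU/abV; rewrite /arc /=; move: aqb pss; clear; cyc q a b s p.
by apply: subset_closure; rewrite /arc /= -[cyc _ _ _]negbK arcC//; apply/negP.
Qed.

Lemma arc_ex x y : x != y -> exists p, cyc x p y.
Proof.
case: (unstereoP x y) => [|s _]; first by rewrite eqxx.
by exists (unstereo x (s - 1)); rewrite cycE; lra.
Qed.

End CircleTopology.

(** * Events as pairs of points; separation and arcs in terms of the cyclic order *)

Section PairsOfPoints.
Variable R : realType.
Implicit Types x y z u v p q : S1 R.
Implicit Types e a b : event R.

Lemma S1_base_subproof : ((1, 0) : R * R) \in circle R.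
Proof. by rewrite inE /circle /= expr1n expr0n addr0. Qed.

Definition S1_base : S1 R := exist (fun c => c \in circle R) _ S1_base_subproof.

Lemma exists_neq2 x y : exists2 z, z != x & z != y.
Proof.
case: (unstereoP x y) => [|s]; first by exists (unstereo x 0); rewrite !cycE.
by exists (unstereo x (s + 1)); rewrite !cycE// -subr_eq0 addrAC subrr add0r oner_eq0.
Qed.

Lemma events_pair x y : x != y -> [set x; y] \in @events R.
Proof. by move=> xy; rewrite inE; exists x, y. Qed.

Definition event0 : event R := exist (fun s => s \in @events R) _
  (events_pair (negbT (unstereo_base S1_base 0))).

(* A junk value when x = y. *)
Definition ev x y : event R := insubd event0 [set x; y].

Lemma pts_ev x y : x != y -> pts (ev x y) = [set x; y].
Proof. by move=> xy; rewrite /pts /ev val_insubd events_pair. Qed.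

Lemma event_ext e a : pts e = pts a -> e = a.
Proof. exact: val_inj. Qed.

Lemma evC x y : ev x y = ev y x.
Proof. by rewrite /ev [in LHS]setUC. Qed.

Lemma set2_inj x y z u : x != y -> [set x; y] = [set z; u] ->
  (x = z /\ y = u) \/ (x = u /\ y = z).
Proof.
move=> + e.
have : [set z; u] x by rewrite -e; left.
have : [set z; u] y by rewrite -e; right.
by move=> [] -> [] ->; rewrite ?eqxx => //; tauto.
Qed.

Lemma event_pair e : exists x y, x != y /\ e = ev x y.
Proof.
have [x [y [xy E]]] := set_valP e; exists x, y; split => //.
by apply: event_ext; rewrite pts_ev.
Qed.

Lemma pair_of_ev x y : x != y -> pair_of (ev x y) x y.
Proof. exact: pts_ev. Qed.

Lemma pair_ofE e x y : pair_of e x y <-> x != y /\ e = ev x y.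
Proof.
split=> [h|[xy ->]]; last exact: pair_of_ev.
suff xy : x != y by split => //; apply: event_ext; rewrite pts_ev.
have [z [u [zu E]]] := event_pair e; apply/eqP => xy.
move: h; rewrite /pair_of E pts_ev// xy => /(set2_inj zu)[] [h1 h2];
by rewrite h1 h2 eqxx in zu.
Qed.

Lemma ev_inj x y z u : x != y -> z != u -> ev x y = ev z u ->
  (x = z /\ y = u) \/ (x = u /\ y = z).
Proof. by move=> xy zu /(congr1 (@pts R)); rewrite !pts_ev//; exact: set2_inj. Qed.

Lemma light_lineE x e : light_line x e <-> pts e x.
Proof.
split=> [[y _ ->]|]; first by left.
have [y [z [yz ->]]] := event_pair e; rewrite pts_ev// => -[] ->.
  by exists z; [rewrite eq_sym|apply: pair_of_ev].
by exists y => //; rewrite evC; apply: pair_of_ev; rewrite eq_sym.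
Qed.

Lemma on_light_lineE e a : on_light_line e a <-> exists x, pts e x /\ pts a x.
Proof. by split=> -[x [h1 h2]]; exists x; split; apply/light_lineE. Qed.

Lemma on_light_line_ev x y z u : x != y -> z != u ->
  on_light_line (ev x y) (ev z u) <-> ~~ [&& x != z, x != u, y != z & y != u].
Proof.
move=> xy zu; rewrite on_light_lineE !pts_ev//; split.
  by case=> p [[] -> [] ->]; rewrite eqxx ?andbF.
case: (eqVneq x z) => [<- _|_]; first by exists x; split; left.
case: (eqVneq x u) => [<- _|_]; first by exists x; split; [left|right].
case: (eqVneq y z) => [<- _|_]; first by exists y; split; [right|left].
by case: (eqVneq y u) => [<- _|//]; exists y; split; right.
Qed.

Lemma event_pt e x : pts e x -> exists2 y, x != y & e = ev x y.
Proof.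
have [z [u [zu ->]]] := event_pair e; rewrite pts_ev// => -[] ->.
  by exists u.
by exists z; [rewrite eq_sym|rewrite evC].
Qed.

Lemma ev_of_pts e x y : x != y -> pts e x -> pts e y -> e = ev x y.
Proof.
move=> xy /event_pt[z xz ->]; rewrite pts_ev// => -[e1|->//].
by rewrite e1 eqxx in xy.
Qed.

Lemma on_light_refl a : on_light_line a a.
Proof.
have [x [y [xy ->]]] := event_pair a; apply/on_light_lineE.
by exists x; rewrite pts_ev//; split; left.
Qed.

Lemma on_light_causal a a' : on_light_line a a' -> causal a a'.
Proof.
move=> /on_light_lineE[x [ax ax']] [dis _].
by have : (set0 : set (S1 R)) x by rewrite -dis.
Qed.

(** The decidable form of [separate], in which the two pairs alternate around the circle. *)
Definition sep x y z u : bool := cyc4 x z y u || cyc4 x u y z.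

Lemma sep_swap x y z u : sep x y z u = sep z u x y.
Proof. by apply/idP/idP; rewrite /sep; cyc x y z u. Qed.

Lemma sepCl x y z u : sep x y z u = sep y x z u.
Proof. by apply/idP/idP; rewrite /sep; cyc x y z u. Qed.

Lemma sepCr x y z u : sep x y z u = sep x y u z.
Proof. by rewrite /sep orbC. Qed.

Lemma sep_uniq x y z u : sep x y z u ->
  [&& x != y, x != z, x != u, y != z, y != u & z != u].
Proof. by rewrite /sep; cyc x y z u. Qed.

Lemma cyc4_nonsep x y z u : cyc4 x y z u -> ~~ sep x y z u /\ ~~ sep x u y z.
Proof. by move=> k; apply/andP; move: k; rewrite /sep; cyc x y z u. Qed.

(** Exactly one of the three pairings of four points separates. Excluding two of them leaves
    [(x, z)], [(y, u)], which fixes the cyclic order up to reversal. *)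
Lemma nonsep_cyc4 x y z u : uniq [:: x; y; z; u] -> ~~ sep x y z u ->
  ~~ sep x u y z -> cyc4 x y z u || cyc4 u z y x.
Proof. by rewrite uniq4 /sep; cyc x y z u. Qed.

(** By [component_arc] the components of the complement of an event are its two open arcs, so the
    topological condition becomes one on the cyclic order. *)
Lemma separate_ev x y z u : x != y -> z != u ->
  separate (ev x y) (ev z u) <-> sep x y z u.
Proof.
move=> xy zu; rewrite /separate !pts_ev//; split.
  move=> [dis /(_ z u (pair_of_ev zu)) h].
  have nin v : [set z; u] v -> ~ [set x; y] v.
    by move=> zv xv; have : (set0 : set (S1 R)) v by rewrite -dis.
  have zxy : ~ [set x; y] z by apply: nin; left.
  have uxy : ~ [set x; y] u by apply: nin; right.
  have zx : z != x by apply/eqP => e; apply: zxy; left.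
  have zy : z != y by apply/eqP => e; apply: zxy; right.
  have ux : u != x by apply/eqP => e; apply: uxy; left.
  have uy : u != y by apply/eqP => e; apply: uxy; right.
  have yx : y != x by rewrite eq_sym.
  case: (boolP (cyc x z y)) => [hz|]; last rewrite arcC// => hz.
    case: (boolP (cyc x u y)) => [hu|]; last rewrite arcC// => hu.
      by case: h; rewrite !component_arc.
    by move: hz hu; rewrite /sep; clear; cyc x y z u.
  case: (boolP (cyc x u y)) => [hu|]; last rewrite arcC// => hu.
    by move: hz hu; rewrite /sep; clear; cyc x y z u.
  by case: h; rewrite setUC !component_arc.
move=> s; split.
  rewrite -subset0 => p [[] -> [] e]; move: s; rewrite e; move/sep_uniq; rewrite eqxx ?andbF //.
have gen z' u' : cyc4 x z' y u' ->
    connected_component (~` [set x; y]) z' <> connected_component (~` [set x; y]) u'.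
  move=> /andP[h1 h2]; have h3 : cyc y u' x by rewrite -cyc_rot.
  rewrite component_arc// setUC (component_arc h3).
  move=> /seteqP[/(_ z') h _]; have := h h1; rewrite /arc /=.
  by move: h1; clear; cyc x y z'.
move=> z' u'; rewrite /pair_of pts_ev// => /(set2_inj zu)[] [<- <-]; move/orP: s => [].
- exact: gen.
- by move=> h; apply/nesym; exact: gen.
- by move=> h; apply/nesym; exact: gen.
- exact: gen.
Qed.

Lemma causal_ev x y z u : x != y -> z != u ->
  causal (ev x y) (ev z u) <-> ~~ sep x y z u.
Proof. by move=> xy zu; rewrite /causal separate_ev//; split => /negP. Qed.

Lemma is_arc_ev x y A : x != y -> is_arc (ev x y) A <-> A = ~` arc x y \/ A = ~` arc y x.
Proof.
move=> xy; have yx : y != x by rewrite eq_sym.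
rewrite /is_arc pts_ev//; split.
  case=> p /not_orP[/eqP px /eqP py] ->.
  case: (boolP (cyc x p y)) => [h|]; last rewrite arcC// => h.
    by right; rewrite component_arc// closure_arc.
  by left; rewrite setUC component_arc// closure_arc.
case=> ->.
  have [p pyx] := arc_ex yx; exists p; last by rewrite setUC component_arc// closure_arc.
  by move=> [] e; move: pyx; rewrite e (cycxyy, cycxxy).
have [p pxy] := arc_ex xy; exists p; last by rewrite component_arc// closure_arc.
by move=> [] e; move: pxy; rewrite e (cycxyy, cycxxy).
Qed.

Lemma arc_cone_ev A z u : z != u -> arc_cone A (ev z u) <-> A z /\ A u.
Proof.
move=> zu; rewrite /arc_cone /= pts_ev//; split=> [h|[Az Au] p [] -> //].
by split; apply: h; [left|right].
Qed.

Lemma event_atP (h : event R -> set (event R)) e x :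
  (exists a, h e a /\ pts a x) -> h e (event_at h e x) /\ pts (event_at h e x) x.
Proof.
by move=> ex; rewrite /event_at; case: xgetP => [a _ []//|]; case: ex => a /[swap]/[apply].
Qed.

Lemma event_atE (h : event R -> set (event R)) e a x :
  (exists! a, h e a /\ pts a x) -> h e a -> pts a x -> event_at h e x = a.
Proof.
move=> [b [hb bU]] ha ax; have [h1 h2] := @event_atP h e x (ex_intro _ a (conj ha ax)).
by rewrite -(bU _ (conj h1 h2)) (bU _ (conj ha ax)).
Qed.

End PairsOfPoints.

(** * Logarithmic distances: harmonic pairs and uniqueness of common perpendiculars *)

Section LogMetric.
Variable R : realType.
Implicit Types x y z u v p q w : S1 R.

(* For the logarithm G of a semi-metric, lm_mono is axiom (M), and lm_surj is
   equivalent to (T) in the presence of (M). *)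
Record log_moebius (G : S1 R -> S1 R -> R) : Prop := {
  lm_sym : forall x y, G x y = G y x;
  lm_mono : forall x y z u, cyc4 x y z u -> G x y + G z u < G x z + G y u;
  lm_surj : forall p w (s : R), p != w -> exists2 y, cyc p y w & G p y - G w y = s
}.

Variable G : S1 R -> S1 R -> R.
Hypothesis hG : log_moebius G.
Let Gs := lm_sym hG.

(** The logarithm of the ratio of the distances from [z] to [x] and to [y]. It serves as a
    coordinate on the line of [(x, y)]: the two ends of an event of that line have the same
    value. *)
Definition lr x y z : R := G x z - G y z.

(** For [x], [v], [v'], [y] in cyclic order the inequality [lm_mono] says precisely that [lr x y]
    increases from [v] to [v']. *)
Lemma lr_lt x y z z' : cyc x z y -> cyc x z' y ->
  (lr x y z < lr x y z') = cyc x z z'.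
Proof.
have mono v v' : cyc x v v' -> cyc x v' y -> lr x y v < lr x y v'.
  move=> h h'; have /(lm_mono hG) : cyc4 x v v' y by rewrite /cyc4 h.
  by rewrite /lr (Gs y v) (Gs y v'); lra.
move=> xzy xzy'; apply/idP/idP; last by move=> h; exact: mono.
apply: contraTT => h; rewrite -leNgt.
have [->//|zz'] := eqVneq z z'; apply/ltW/mono => //.
by move: h zz' xzy xzy'; clear; cyc x y z z'.
Qed.

Lemma lr_inj x y z z' : cyc x z y -> cyc x z' y -> lr x y z = lr x y z' -> z = z'.
Proof.
move=> h h' e; have := lr_lt h h'; have := lr_lt h' h; rewrite e ltxx => h1 h2.
by apply/eqP; move: h h' h1 h2; clear; cyc x y z z'.
Qed.

Lemma lrC x y z : lr y x z = - lr x y z.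
Proof. by rewrite /lr opprB. Qed.

(** The pairs [(x, y)] and [(z, u)] are in harmonic position. For four distinct points [harm_sep]
    shows that they then separate each other. *)
Definition harm x y z u : Prop := lr x y z = lr x y u.

Lemma harm_swap x y z u : harm x y z u -> harm z u x y.
Proof. by rewrite /harm /lr (Gs z x) (Gs u x) (Gs z y) (Gs u y); lra. Qed.

Lemma harmCl x y z u : harm x y z u -> harm y x z u.
Proof. by rewrite /harm !(lrC x y) => ->. Qed.

Lemma harmCr x y z u : harm x y z u -> harm x y u z.
Proof. by []. Qed.

(** Otherwise [z] and [u] lie on the same open arc of [(x, y)], where [lr] is injective. *)
Lemma harm_sep x y z u :
  [&& x != y, x != z, x != u, y != z, y != u & z != u] -> harm x y z u -> sep x y z u.
Proof.
move=> /and5P[xy xz xu yz /andP[yu zu]] h; apply: contraT => ns.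
suff [] : (cyc x z y /\ cyc x u y) \/ (cyc y z x /\ cyc y u x).
- by move=> [h1 h2]; rewrite (lr_inj h1 h2 h) eqxx in zu.
- by move=> [h1 h2]; rewrite (lr_inj h1 h2 (harmCl h)) eqxx in zu.
case: (boolP (cyc x z y)) => hz; [left|right]; split => //;
 by move: hz ns xy xz xu yz yu zu; clear; rewrite /sep; cyc x y z u.
Qed.

(** By [lm_surj] the value of [lr x y] at [z] is also taken on the opposite arc. *)
Lemma harm_ex x y z : x != y -> x != z -> y != z ->
  exists2 u, sep x y z u & harm x y z u.
Proof.
have ex x' y' : cyc x' z y' -> exists2 u, cyc y' u x' & harm x' y' z u.
  move=> h; have /and3P[_ _ xy'] := cyc_neq h.
  have [|u h1 h2] := @lm_surj _ hG y' x' (- lr x' y' z); first by rewrite eq_sym.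
  by exists u => //; move: h2; rewrite /harm /lr; lra.
move=> xy xz yz; case: (boolP (cyc x z y)) => [hz|hz].
  have [u h1 h2] := ex _ _ hz; exists u => //.
  by move: hz h1; clear; rewrite /sep; cyc x y z u.
have hz' : cyc y z x by move: hz xy xz yz; clear; cyc x y z.
have [u h1 h2] := ex _ _ hz'; exists u; last exact: harmCl.
by move: hz' h1; clear; rewrite /sep; cyc x y z u.
Qed.

Lemma harm_uniq x y z u u' : sep x y z u -> sep x y z u' ->
  harm x y z u -> harm x y z u' -> u = u'.
Proof.
move=> s s' h h'.
have : (cyc x u y && cyc x u' y) || (cyc y u x && cyc y u' x).
  by move: s s'; clear; rewrite /sep; cyc x y z u u'.
case/orP => /andP[h1 h2]; first by apply: (lr_inj h1 h2); rewrite -h.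
by apply: (lr_inj h1 h2); rewrite -(harmCl h) (harmCl h').
Qed.

(** On both arcs [lr x y] increases from [x] to [y], counterclockwise on one and clockwise on the
    other. The involution that exchanges points of equal value therefore reverses the cyclic
    order. *)
Lemma harm_rev x y z u z' u' : cyc4 x z y u -> cyc4 x z' y u' ->
  harm x y z u -> harm x y z' u' -> cyc x z z' = cyc y u' u.
Proof.
move=> /andP[h1 h2] /andP[h1' h2'] h h'.
have k : cyc y u x by rewrite -cyc_rot.
have k' : cyc y u' x by rewrite -cyc_rot.
rewrite -(lr_lt h1 h1') -(lr_lt k' k).
by rewrite !(lrC x y) -h -h' ltrN2.
Qed.

Lemma harm_nonsep x y z u z' u' : sep x y z u -> sep x y z' u' ->
  harm x y z u -> harm x y z' u' -> ~~ sep z u z' u'.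
Proof.
have gen v t v' t' : cyc4 x v y t -> cyc4 x v' y t' ->
    harm x y v t -> harm x y v' t' -> ~~ sep v t v' t'.
  move=> c c' h h'; have := harm_rev c c' h h'; have := harm_rev c' c h' h.
  by move: c c'; clear; rewrite /sep; cyc x y v t v' t'.
move=> /orP[] s /orP[] s' h h'.
- exact: gen.
- by rewrite sepCr; exact: gen.
- by rewrite sepCl; exact: gen.
- by rewrite sepCl sepCr; exact: gen.
Qed.

(* The lengths of the segments cut out by (z, u), (z', u') on two common
   perpendiculars would be comparable in both senses. *)
Lemma perp_uniq_aux x y x' y' z u z' u' :
  cyc4 u x x' z -> cyc4 u z z' u' -> cyc4 z' y' y u' ->
  harm x y z u -> harm x y z' u' -> harm x' y' z u -> harm x' y' z' u' -> False.
Proof.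
move=> c1 c2 c3; rewrite /harm /lr => h1 h2 h3 h4.
have [d1 d2] : cyc u z u' /\ cyc u z' u'.
  by apply/andP; move: c2; clear; cyc u z z' u'.
have [d3 d4] : cyc u z z' /\ cyc z z' u'.
  by apply/andP; move: c2; clear; cyc u z z' u'.
have i1 : cyc4 x' z z' x by move: c1 d3; clear; cyc u x x' z z'.
have i2 : cyc4 z' y' y z by move: d4 c3; clear; cyc z z' y' y u'.
have i3 : cyc4 u x x' u' by move: c1 d1; clear; cyc u x x' z u'.
have i4 : cyc4 y u' u y' by move: d2 c3; clear; cyc u z' y' y u'.
have := lm_mono hG i1; have := lm_mono hG i2.
have := lm_mono hG i3; have := lm_mono hG i4.
move: (Gs z x) (Gs z' x) (Gs z' y') (Gs y z) (Gs z' y) (Gs u x) (Gs u x').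
move: (Gs y u') (Gs u y') (Gs u' y') (Gs x' u').
lra.
Qed.

(** If [x = v], the other ends agree by [harm_uniq]. Otherwise [x] and [v] are ordered on the arc
    from [u1] to [z1]; the involution of [(z1, u1)] orders [y] and [w] accordingly, so one
    perpendicular is the outer one and [perp_uniq_aux] applies. *)
Lemma perp_uniq_sorted x y z1 u1 z2 u2 v w :
  cyc4 x z1 y u1 -> cyc4 x z2 y u2 -> cyc x z1 z2 ->
  cyc4 z1 w u1 v -> sep v w z2 u2 -> harm x y z1 u1 -> harm x y z2 u2 ->
  harm v w z1 u1 -> harm v w z2 u2 -> x = v /\ y = w.
Proof.
move=> c1 c2 c12 cw s2 h1 h2 h3 h4; have r := harm_rev c1 c2 h1 h2.
have cy : cyc4 z1 y u1 x by move: c1; clear; cyc x y z1 u1.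
have r1 := harm_rev cy cw (harmCr (harm_swap h1)) (harmCr (harm_swap h3)).
have r2 := harm_rev cw cy (harmCr (harm_swap h3)) (harmCr (harm_swap h1)).
rewrite c12 in r.
have [xv|xv] := eqVneq x v.
  subst v; split => //.
  apply: (harm_uniq (x := z1) (y := u1) (z := x)); last 2 first.
  - exact: harm_swap h1.
  - exact: harm_swap h3.
  - by move: cy; clear; rewrite /sep; cyc z1 y u1 x.
  - by move: cw; clear; rewrite /sep; cyc z1 w u1 x.
have cx : cyc4 u1 x v z1 \/ cyc4 u1 v x z1.
  case: (boolP (cyc u1 x v)) => hx; [left|right].
    by move: hx cw; clear; cyc u1 x v z1 w.
  by move: hx cw cy xv; clear; cyc u1 x v z1 w.
have cz : cyc4 u1 z1 z2 u2.
  have d1 : cyc4 x z1 z2 u2 by move: c2 c12; clear; cyc x z1 z2 y u2.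
  have d2 : cyc x u2 u1.
    by case/andP: c1 => _; case/andP: c2 => _; move: r; clear; cyc x y u1 u2.
  by move: d1 d2; clear; cyc x z1 z2 u1 u2.
have cz' : cyc z1 z2 u2 by move: cz; clear; cyc u1 z1 z2 u2.
have dw : cyc z2 w u2.
  have d1 : cyc u2 v z2.
    by case/andP: cw => _; move: cz; clear; cyc u1 z1 z2 u2 v.
  by move: d1 s2; clear; rewrite /sep; cyc z2 u2 v w.
have dy : cyc z2 y u2 by move: c2; clear; cyc x z2 y u2.
exfalso; case: cx => cx.
  apply: (perp_uniq_aux cx cz _ h1 h2 h3 h4).
  have : cyc z1 w y by rewrite r2; move: cx; clear; cyc u1 x v z1.
  by move: cz' dw dy; clear; cyc z1 z2 u2 w y.
apply: (perp_uniq_aux cx cz _ h3 h4 h1 h2).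
have : cyc z1 y w by rewrite r1; move: cx; clear; cyc u1 x v z1.
by move: cz' dw dy; clear; cyc z1 z2 u2 w y.
Qed.

(** Reduction to the sorted case by symmetry: [nf2] exchanges the ends of the second perpendicular,
    [nf3] exchanges the two events, and the four final cases exchange the ends of the events. *)
Lemma perp_uniq x y x' y' z u z' u' :
  ~ (z = z' /\ u = u') -> ~ (z = u' /\ u = z') ->
  sep x y z u -> sep x y z' u' -> sep x' y' z u -> sep x' y' z' u' ->
  harm x y z u -> harm x y z' u' -> harm x' y' z u -> harm x' y' z' u' ->
  (x = x' /\ y = y') \/ (x = y' /\ y = x').
Proof.
have nf2 z1 u1 z2 u2 v w : cyc4 x z1 y u1 -> cyc4 x z2 y u2 -> cyc x z1 z2 ->
    sep v w z1 u1 -> sep v w z2 u2 -> harm x y z1 u1 -> harm x y z2 u2 ->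
    harm v w z1 u1 -> harm v w z2 u2 -> (x = v /\ y = w) \/ (x = w /\ y = v).
  move=> c1 c2 c12; rewrite {1}/sep => /orP[] s1 s2 h1 h2 h3 h4.
    left; apply: (perp_uniq_sorted c1 c2 c12 _ s2 h1 h2 h3 h4).
    by move: s1; clear; cyc v w z1 u1.
  right; apply: (perp_uniq_sorted c1 c2 c12 _ _ h1 h2 (harmCl h3) (harmCl h4)).
    by move: s1; clear; cyc v w z1 u1.
  by rewrite sepCl.
have nf3 z1 u1 z2 u2 : cyc4 x z1 y u1 -> cyc4 x z2 y u2 -> ~ (z1 = z2 /\ u1 = u2) ->
    sep x' y' z1 u1 -> sep x' y' z2 u2 -> harm x y z1 u1 -> harm x y z2 u2 ->
    harm x' y' z1 u1 -> harm x' y' z2 u2 ->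
    (x = x' /\ y = y') \/ (x = y' /\ y = x').
  move=> c1 c2 ne s1 s2 h1 h2 h3 h4.
  case: (boolP (cyc x z1 z2)) => c12.
    exact: (nf2 _ _ _ _ _ _ c1 c2 c12).
  have c21 : cyc x z2 z1.
    have : z1 != z2.
      apply/eqP => e; apply: ne; split=> //; subst z2.
      by apply: (harm_uniq _ _ h1 h2); rewrite /sep (c1, c2).
    by move: c12 c1 c2; clear; cyc x z1 y z2.
  exact: (nf2 _ _ _ _ _ _ c2 c1 c21).
move=> n1 n2 /orP[] s1 /orP[] s2 s3 s4 h1 h2 h3 h4.
- exact: (nf3 _ _ _ _ s1 s2).
- by apply: (nf3 _ _ _ _ s1 s2) => //; rewrite sepCr.
- by apply: (nf3 _ _ _ _ s1 s2) => //; rewrite 1?sepCr// => -[? ?]; apply: n2.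
- by apply: (nf3 _ _ _ _ s1 s2) => //; rewrite 1?sepCr// => -[? ?]; apply: n1.
Qed.

End LogMetric.

(** * Existence of common perpendiculars *)

Section MonotoneFixpoint.
Variable R : realType.

(** The Knaster-Tarski argument: the supremum of the points with [s <= g s] is fixed. *)
Lemma monotone_fixpoint (a b : R) (g : R -> R) : a <= b ->
  (forall s, a <= s <= b -> a <= g s <= b) ->
  (forall s t, a <= s -> s <= t -> t <= b -> g s <= g t) ->
  exists2 s, a <= s <= b & g s = s.
Proof.
move=> ab gab gm; pose S := [set s | a <= s <= b /\ s <= g s].
have Sa : S a.
  by have aab : a <= a <= b by [rewrite lexx]; split => //; case/andP: (gab _ aab).
have hS : has_sup S by split; [exists a|exists b => s [/andP[]]].
have s_in : a <= sup S <= b.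
  rewrite (ub_le_sup (proj2 hS) Sa) /=; apply: ge_sup; first by exists a.
  by move=> s [/andP[]].
have s_le : sup S <= g (sup S).
  apply: ge_sup; first by exists a.
  move=> s Ss; have /andP[as_ sb] := Ss.1; apply: (le_trans Ss.2).
  by apply: gm => //; [exact: (ub_le_sup (proj2 hS))|case/andP: s_in].
exists (sup S) => //; apply/eqP; rewrite eq_le s_le andbT.
apply: (ub_le_sup (proj2 hS)); split; first exact: gab.
by apply: gm => //; [case/andP: s_in|case/andP: (gab _ s_in)].
Qed.

End MonotoneFixpoint.

Section CommonPerpendicular.
Variable R : realType.
Variable G : S1 R -> S1 R -> R.
Hypothesis hG : log_moebius G.

(* A fixed point of the composition of the two involutions defined by (z, u)
   and (z', u'), which is an increasing self-map of the arc from z to u. *)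
Lemma perp_exists z u z' u' : cyc4 z u u' z' -> exists x y,
  [/\ sep x y z u, sep x y z' u', harm G x y z u & harm G x y z' u'].
Proof.
case: (unstereoP z' z) => [|a]; first by rewrite /cyc4 cycxyx andbF.
case: (unstereoP z' u) => [|b]; first by stereo z' u'; cyc_done.
case: (unstereoP z' u') => [|c]; first by rewrite /cyc4 cycxyy andbF.
set U := unstereo z'; rewrite /cyc4 !cycE => /andP[abc ac].
have [ab bc] : a < b /\ b < c by split; lra.
(* With [z'] at infinity, the involution of [(z', u')] carries the interval from [a] to [b] beyond
   [c], and the involution of [(z, u)] carries it back between [a] and [b]. *)
have step1 s : a <= s <= b -> exists2 d, c < d & harm G z' (U c) (U s) (U d).
  move=> sab; have [||| y] := @harm_ex _ _ hG z' (U c) (U s); rewrite ?cycE//; first lra.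
  by case: (unstereoP z' y) => [|d]; rewrite /sep /cyc4 !cycE => h hd; [lra|exists d => //; lra].
have step2 d : c < d -> exists2 t, a < t < b & harm G (U a) (U b) (U d) (U t).
  move=> cd; have [||| y] := @harm_ex _ _ hG (U a) (U b) (U d); rewrite ?cycE//; try lra.
  by case: (unstereoP z' y) => [|t]; rewrite /sep /cyc4 !cycE => h hd; [lra|exists t => //; lra].
(* Stated for every real [s], so that [choice] yields a function on the whole line; the value 0
   outside the interval is arbitrary. *)
have step s : exists t, a <= s <= b -> exists d, [/\ c < d, a < t < b,
    harm G z' (U c) (U s) (U d) & harm G (U a) (U b) (U d) (U t)].
  case: (boolP (a <= s <= b)) => [h|_]; last by exists 0.
  by have [d cd h1] := step1 _ h; have [t ht h2] := step2 _ cd; exists t => _; exists d.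
have [g hg] := choice step.
have [||| s sab gs] := @monotone_fixpoint R a b g; first exact: ltW.
- by move=> s /hg[d [_ h _ _]]; lra.
- move=> s t as_ st tb; have [->//|nst] := eqVneq s t.
  have [|d [cd ht h1 h2]] := hg s; first lra.
  have [|d' [cd' ht' h1' h2']] := hg t; first lra.
  have r : cyc z' (U s) (U t) = cyc (U c) (U d') (U d).
    by apply: (harm_rev hG _ _ h1 h1'); rewrite /cyc4 !cycE; lra.
  have r' : cyc (U b) (U d') (U d) = cyc (U a) (U (g s)) (U (g t)).
    by apply: (harm_rev hG _ _ (harmCl h2') (harmCl h2)); rewrite /cyc4 !cycE; lra.
  move: r r'; rewrite !cycE => r r'.
  have k1 : s < t by rewrite lt_neqAle nst.
  have k2 : d' < d by move: r; rewrite k1; lra.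
  by move: r'; rewrite k2; lra.
have [d [cd ht h1 h2]] := hg _ sab.
exists (U s), (U d); split.
- by rewrite /sep /cyc4 !cycE; lra.
- by rewrite /sep /cyc4 !cycE; lra.
- by rewrite gs in h2; exact: (harmCl (harm_swap hG h2)).
- exact: (harm_swap hG h1).
Qed.

End CommonPerpendicular.

(** * Lines and times of a semi-metric *)

Section SemimetricSpace.
Variable R : realType.
Variable d : semimetric R.
Implicit Types x y z u p q : S1 R.
Implicit Types e a : event R.

Lemma fdist_sym x y : fdist d x y = fdist d y x.
Proof. by rewrite /fdist (sm_sym (sm_distP d)). Qed.

Lemma fdist_gt0 x y : x != y -> 0 < fdist d x y.
Proof. by move=> /(sm_pos (sm_distP d)); rewrite /fdist; case: (sm_dist d x y). Qed.

(** Infinite distances, replaced by 1 in [fdist], get the logarithm 0. *)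
Definition ld x y : R := ln (fdist d x y).

Lemma ld_sym x y : ld x y = ld y x.
Proof. by rewrite /ld fdist_sym. Qed.

Lemma ln_quot p q p' q' r s r' s' : p != q -> p' != q' -> r != s -> r' != s' ->
  ln ((fdist d p q * fdist d p' q') / (fdist d r s * fdist d r' s')) =
  ld p q + ld p' q' - (ld r s + ld r' s').
Proof.
move=> /fdist_gt0 h1 /fdist_gt0 h2 /fdist_gt0 h3 /fdist_gt0 h4.
by rewrite ln_div ?posrE ?mulr_gt0// !lnM ?posrE.
Qed.

Lemma fdist_mulE p q p' q' r s r' s' : p != q -> p' != q' -> r != s -> r' != s' ->
  fdist d p q * fdist d p' q' = fdist d r s * fdist d r' s' <->
  ld p q + ld p' q' = ld r s + ld r' s'.
Proof.
move=> /fdist_gt0 h1 /fdist_gt0 h2 /fdist_gt0 h3 /fdist_gt0 h4.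
rewrite /ld -!lnM ?posrE//; split=> [->//|/ln_inj]; apply; by rewrite posrE mulr_gt0.
Qed.

Hypothesis hd : log_moebius ld.

(** The equation that defines a line does not depend on the labelling of the two events, and it
    forces separation by [harm_sep]. *)
Lemma sm_line_ev x y z u : x != y -> z != u ->
  sm_line d (ev x y) (ev z u) <-> sep x y z u /\ harm ld x y z u.
Proof.
move=> xy zu; split.
  case=> p [q [r [s []]]].
  move=> /pair_ofE[pq E1] /pair_ofE[rs E2]; rewrite uniq4 => U /fdist_mulE h.
  have H : harm ld p q r s.
    move: U h => /and5P[_ pr ps qr /andP[qs _]] h.
    by rewrite /harm /lr; have := h pr qs ps qr; lra.
  have S := harm_sep hd U H.
  have {}H := harm_swap hd H; rewrite sep_swap in S.
  case: (ev_inj xy rs E2) => -[-> ->]; case: (ev_inj zu pq E1) => -[-> ->].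
  - by [].
  - by rewrite sepCr; split=> //; apply: harmCr.
  - by rewrite sepCl; split=> //; apply: harmCl.
  - by rewrite sepCl sepCr; split=> //; apply/harmCl/harmCr.
move=> [S H]; exists z, u, x, y; have {}H := harm_swap hd H; rewrite sep_swap in S.
have := sep_uniq S; rewrite -uniq4 => U; split => //.
- exact: pair_of_ev.
- exact: pair_of_ev.
move: U; rewrite uniq4 => /and5P[_ zx zy ux /andP[uy _]].
by apply/fdist_mulE => //; move: H; rewrite /harm /lr; lra.
Qed.

Lemma sm_lineC e a : sm_line d e a -> sm_line d a e.
Proof.
have [x [y [xy ->]]] := event_pair e; have [z [u [zu ->]]] := event_pair a.
move=> /(sm_line_ev xy zu)[s H]; apply/(sm_line_ev zu xy).
by rewrite sep_swap; split => //; apply: harm_swap.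
Qed.

Lemma sm_line_in x y a : x != y -> sm_line d (ev x y) a ->
  exists z u, [/\ z != u, a = ev z u, cyc4 x z y u & harm ld x y z u].
Proof.
move=> xy; have [z [u [zu ->]]] := event_pair a.
move/(sm_line_ev xy zu) => -[/orP[] s H]; first by exists z, u.
by exists u, z; rewrite eq_sym evC.
Qed.

Lemma in_sm_line x y z u : sep x y z u -> harm ld x y z u -> sm_line d (ev x y) (ev z u).
Proof.
by move=> s H; have /and5P[xy _ _ _ /andP[_ zu]] := sep_uniq s; apply/(sm_line_ev xy zu).
Qed.

Lemma sm_line_sep e a : sm_line d e a -> separate a e.
Proof.
have [x [y [xy ->]]] := event_pair e; have [z [u [zu ->]]] := event_pair a.
by move=> /(sm_line_ev xy zu)[s _]; apply/(separate_ev zu xy); rewrite sep_swap.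
Qed.

Lemma sm_line_at e x : ~ pts e x -> exists! a, sm_line d e a /\ pts a x.
Proof.
have [y [z [yz ->]]] := event_pair e; rewrite pts_ev// => nx.
have yx : y != x by apply/eqP => h; apply: nx; left.
have zx : z != x by apply/eqP => h; apply: nx; right.
have [u s H] := harm_ex hd yz yx zx.
have /and5P[_ _ yu _ /andP[zu xu]] := sep_uniq s.
exists (ev x u); split.
  by split; [exact: in_sm_line|rewrite pts_ev//; left].
move=> a [l /event_pt[v xv aE]]; rewrite aE; congr ev; rewrite aE in l.
have [s' H'] := iffLR (sm_line_ev yz xv) l.
exact: (harm_uniq hd s s' H H').
Qed.

Lemma sm_line_eq e a a' : sm_line d e a -> sm_line d e a' -> on_light_line a a' -> a = a'.
Proof.
move=> h h' /on_light_lineE[x [ax a'x]].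
have nx : ~ pts e x.
  have [dis _] := sm_line_sep h => ex.
  by have : (set0 : set (S1 R)) x by rewrite -dis.
by have [b [_ bU]] := sm_line_at nx; rewrite -(bU a)// -(bU a').
Qed.

Lemma sm_line_perp_uniq e e' a a' : a != a' -> sm_line d e a -> sm_line d e a' ->
  sm_line d e' a -> sm_line d e' a' -> e = e'.
Proof.
have [x [y [xy ->]]] := event_pair e; have [x' [y' [xy' ->]]] := event_pair e'.
have [z [u [zu ->]]] := event_pair a; have [z' [u' [zu' ->]]] := event_pair a'.
move=> ne /(sm_line_ev xy zu)[s1 h1] /(sm_line_ev xy zu')[s2 h2].
move=> /(sm_line_ev xy' zu)[s3 h3] /(sm_line_ev xy' zu')[s4 h4].
have ne1 : ~ (z = z' /\ u = u') by move=> [e1 e2]; rewrite e1 e2 eqxx in ne.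
have ne2 : ~ (z = u' /\ u = z') by move=> [e1 e2]; rewrite e1 e2 evC eqxx in ne.
by case: (perp_uniq hd ne1 ne2 s1 s2 s3 s4 h1 h2 h3 h4) => -[-> ->] //; rewrite evC.
Qed.

Lemma sm_line_causal e a a' : sm_line d e a -> sm_line d e a' -> causal a a'.
Proof.
have [x [y [xy ->]]] := event_pair e.
have [z [u [zu ->]]] := event_pair a; have [z' [u' [zu' ->]]] := event_pair a'.
move=> /(sm_line_ev xy zu)[s1 h1] /(sm_line_ev xy zu')[s2 h2].
by apply/(causal_ev zu zu'); exact: (harm_nonsep hd s1 s2 h1 h2).
Qed.

Definition line_dist x y z z' : R := `|lr ld x y z' - lr ld x y z|.

Lemma line_distE x y z u z' u' v w p q p' q' :
  x != y -> z != u -> z' != u' -> v != w -> p != q -> p' != q' ->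
  ev x y = ev v w -> ev z u = ev p q -> ev z' u' = ev p' q' ->
  harm ld x y z u -> harm ld x y z' u' ->
  line_dist x y z z' = line_dist v w p p'.
Proof.
move=> xy zu zu' vw pq pq' /(ev_inj xy vw) E /(ev_inj zu pq) E1 /(ev_inj zu' pq') E2.
rewrite /harm => h1 h2; have -> : line_dist v w p p' = line_dist x y p p'.
  case: E => -[-> ->]; rewrite /line_dist ?(lrC _ v w) //.
  by rewrite -opprD normrN.
rewrite /line_dist; congr `|_ - _|.
  by case: E2 => -[e2 e2']; rewrite -?e2'// -?e2.
by case: E1 => -[e1 e1']; rewrite -?e1'// -?e1.
Qed.

(** The common perpendicular is unique, so the time of two events can be read off any line that
    contains both. If they meet, they coincide, and both sides vanish. *)
Lemma sm_time_line x y z u z' u' s : x != y -> z != u -> z' != u' ->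
  sm_line d (ev x y) (ev z u) -> sm_line d (ev x y) (ev z' u') ->
  sm_time d (ev z u) (ev z' u') s <-> s = line_dist x y z z'.
Proof.
move=> xy zu zu' l l'.
have [s1 h1] := iffLR (sm_line_ev xy zu) l.
have [s2 h2] := iffLR (sm_line_ev xy zu') l'.
have ne v w p q p' q' : sep v w p q -> sep v w p' q' ->
    ln ((fdist d v p' * fdist d w p) / (fdist d v p * fdist d w p')) =
    lr ld v w p' - lr ld v w p.
  move=> /sep_uniq/and5P[_ ? _ ? _] /sep_uniq/and5P[_ ? _ ? _].
  by rewrite ln_quot// /lr; lra.
split.
  case=> [[ll ->]|[sc [e [v [w [p [q [p' [q' []]]]]]]]]].
    case/(ev_inj zu zu'): (sm_line_eq l l' ll) => -[e1 e2]; rewrite /line_dist.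
      by rewrite e1 subrr normr0.
    by rewrite h2 e1 subrr normr0.
  move=> /pair_ofE[vw eE] /pair_ofE[pq E1] /pair_ofE[pq' E2] [k1 k2].
  have nE : ev z u != ev z' u'.
    apply/eqP => E; apply: sc.2; rewrite -E.
    by apply/on_light_lineE; exists z; rewrite pts_ev//; split; left.
  have eE' := sm_line_perp_uniq nE l l' k1 k2.
  rewrite eE E1 in k1; rewrite eE E2 in k2.
  have [t1 _] := iffLR (sm_line_ev vw pq) k1.
  have [t2 _] := iffLR (sm_line_ev vw pq') k2.
  rewrite (ne v w p q p' q')// => ->; symmetry.
  by apply: (line_distE _ _ _ _ _ _ _ E1 E2) => //; rewrite eE' eE.
move=> ->; have [ll|nll] := pselect (on_light_line (ev z u) (ev z' u')).
  left; split => //; rewrite /line_dist.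
  case/(ev_inj zu zu'): (sm_line_eq l l' ll) => -[e1 e2].
    by rewrite e1 subrr normr0.
  by rewrite h2 e1 subrr normr0.
right; split; first by split => //; exact: sm_line_causal l l'.
exists (ev x y), x, y, z, u, z', u'; split; rewrite ?pair_ofE//.
by rewrite (ne x y z u z' u').
Qed.

(** After a relabelling the four points are in the cyclic order that [perp_exists] asks for. *)
Lemma causal_perp a a' : strong_causal a a' -> exists e, sm_line d e a /\ sm_line d e a'.
Proof.
have [z [u [zu ->]]] := event_pair a; have [z' [u' [zu' ->]]] := event_pair a'.
move=> [/(causal_ev zu zu') ns /(on_light_line_ev zu zu')/negP].
rewrite negbK => /and4P[zz' zu'' uz' uu'].
have gen p q v w : cyc4 p q v w -> exists e, sm_line d e (ev p q) /\ sm_line d e (ev v w).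
  move=> /(perp_exists hd)[x [y [s1 s2 h1 h2]]]; exists (ev x y).
  by split; apply: in_sm_line => //; rewrite 1?sepCr.
have : (cyc4 z u z' u' || cyc4 z u u' z') || (cyc4 u z z' u' || cyc4 u z u' z').
  by move: ns zz' zu'' uz' uu' zu zu'; clear; rewrite /sep; cyc z u z' u'.
by case/orP => /orP[] /gen; rewrite ?(evC u z) ?(evC u' z').
Qed.

Lemma sm_time_uniq a a' s s' : sm_time d a a' s -> sm_time d a a' s' -> s = s'.
Proof.
have [z [u [zu ->]]] := event_pair a; have [z' [u' [zu' ->]]] := event_pair a'.
case=> [[l ->]|[sc [e [v [w [p [q [p' [q' [Ee E1 E2 [k1 k2] E]]]]]]]]]].
  by case=> [[_ ->]|[[_ []]]].
have st : sm_time d (ev z u) (ev z' u') s.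
  by right; split => //; exists e, v, w, p, q, p', q'.
have /pair_ofE[vw eE] := Ee; rewrite eE in k1 k2.
by move=> st'; rewrite (iffLR (sm_time_line _ vw zu zu' k1 k2) st)
  (iffLR (sm_time_line _ vw zu zu' k1 k2) st').
Qed.

Lemma sm_time_ex a a' : causal a a' -> exists s, sm_time d a a' s.
Proof.
move=> c; have [l|l] := pselect (on_light_line a a'); first by exists 0; left.
have [e [k1 k2]] := causal_perp (conj c l).
move: k1 k2; have [z [u [zu ->]]] := event_pair a.
have [z' [u' [zu' ->]]] := event_pair a'; have [x [y [xy ->]]] := event_pair e => k1 k2.
by exists (line_dist x y z z'); apply/(sm_time_line _ xy zu zu' k1 k2).
Qed.

Definition sm_timeo a a' : option R :=
  if pselect (exists s, sm_time d a a' s) is left ex then Some (sval (cid ex)) else None.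

Lemma sm_timeoE a a' s : sm_timeo a a' = Some s <-> sm_time d a a' s.
Proof.
rewrite /sm_timeo; case: pselect => [ex|nex]; last by split=> // st; case: nex; exists s.
case: (cid ex) => s' st' /=; split=> [[<-//]|st].
by rewrite (sm_time_uniq st st').
Qed.

Lemma event_at_harm x y z u : sep x y z u -> harm ld x y z u ->
  event_at (sm_line d) (ev x y) z = ev z u.
Proof.
move=> s h; have /and5P[xy xz _ yz /andP[_ zu]] := sep_uniq s.
apply: event_atE; last by rewrite pts_ev//; left.
  by apply: sm_line_at; rewrite pts_ev// => -[] e; rewrite e eqxx in xz yz.
exact: in_sm_line.
Qed.

Lemma sm_timeo_at x y z u : x != y -> x != z -> y != z -> x != u -> y != u ->
  sm_timeo (event_at (sm_line d) (ev x y) z) (event_at (sm_line d) (ev x y) u) =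
  Some (line_dist x y z u).
Proof.
move=> xy xz yz xu yu; have [z' s h] := harm_ex hd xy xz yz.
have [u' s' h'] := harm_ex hd xy xu yu.
rewrite (event_at_harm s h) (event_at_harm s' h'); apply/sm_timeoE.
have /and5P[_ _ _ _ /andP[_ zz']] := sep_uniq s.
have /and5P[_ _ _ _ /andP[_ uu']] := sep_uniq s'.
by apply/(sm_time_line _ xy zz' uu') => //; exact: in_sm_line.
Qed.

End SemimetricSpace.

(** * The axioms of a timed causal space for the lines and times of a semi-metric *)

Section Between.
Variable R : realType.
Implicit Types x y z u p q : S1 R.

(** The two disjuncts correspond to the two labellings of the closed arcs of [(x, y)], each the
    complement of an open arc. *)
Lemma between_ev p q x y p' q' : p != q -> x != y -> p' != q' ->
  between (ev p q) (ev x y) (ev p' q') <->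
  (~~ cyc x p y && ~~ cyc x q y) && (~~ cyc y p' x && ~~ cyc y q' x) \/
  (~~ cyc y p x && ~~ cyc y q x) && (~~ cyc x p' y && ~~ cyc x q' y).
Proof.
move=> pq xy pq'; rewrite /between.
have coneE z u v w : v != w -> arc_cone (~` arc z u) (ev v w) <-> ~~ cyc z v u && ~~ cyc z w u.
  move=> vw; rewrite arc_cone_ev// /arc /=; split=> [[/negP-> /negP->]//|/andP[h1 h2]].
  by split; apply/negP.
have arc_ne : ~` arc x y <> ~` arc y x.
  have [r rxy] := arc_ex xy.
  move/seteqP => [_ /(_ r)]; rewrite /arc /= => h; apply: h => //.
  by apply/negP; move: rxy; clear; cyc x y r.
split.
  case=> Am [Ap [/(is_arc_ev _ xy) h1 /(is_arc_ev _ xy) h2 ne]].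
  move: ne; case: h1 h2 => -> [] -> // _.
    by move=> /(coneE _ _ _ _ pq) -> /(coneE _ _ _ _ pq') ->; left.
  by move=> /(coneE _ _ _ _ pq) -> /(coneE _ _ _ _ pq') ->; right.
case=> /andP[h1 h2]; [exists (~` arc x y), (~` arc y x)|exists (~` arc y x), (~` arc x y)].
  by split; [apply/is_arc_ev => //; left|apply/is_arc_ev => //; right| |exact/coneE|exact/coneE].
by split; [apply/is_arc_ev => //; right|apply/is_arc_ev => //; left|apply/nesym|
  exact/coneE|exact/coneE].
Qed.

End Between.

Section TimedCausalSpaceOfSemimetric.
Variable R : realType.
Variable d : semimetric R.
Hypothesis hd : log_moebius (ld d).
Implicit Types x y z u p q : S1 R.
Implicit Types e a : event R.

Lemma sm_time_causal a a' s : sm_time d a a' s -> causal a a'.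
Proof. by case=> [[/on_light_causal]|[[]]]. Qed.

Lemma sm_time_ge0 a a' s : sm_time d a a' s -> 0 <= s.
Proof. by case=> [[_ ->//]|[_ [e [x [y [z [u [z' [u' [_ _ _ _ ->]]]]]]]]]]. Qed.

Lemma strong_causal_line a a' : strong_causal a a' -> exists x y z u z' u',
  [/\ [/\ x != y, z != u & z' != u'], a = ev z u, a' = ev z' u' &
    [/\ sm_line d (ev x y) (ev z u), sm_line d (ev x y) (ev z' u'),
     cyc4 x z y u & cyc4 x z' y u']].
Proof.
move=> /(causal_perp hd)[e]; have [x [y [xy ->]]] := event_pair e => -[l l'].
have [z [u [zu aE c _]]] := sm_line_in hd xy l.
have [z' [u' [zu' aE' c' _]]] := sm_line_in hd xy l'.
by exists x, y, z, u, z', u'; split => //; rewrite -aE -aE'.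
Qed.

Lemma sm_time0 a a' : sm_time d a a' 0 <-> on_light_line a a'.
Proof.
split; last by left.
move=> st; have [//|nl] := pselect (on_light_line a a').
have sc : strong_causal a a' by split => //; exact: sm_time_causal st.
have [x [y [z [u [z' [u' [[xy zu zu'] aE aE' [l l' c c']]]]]]]] := strong_causal_line sc.
rewrite aE aE' in st *; have := iffLR (sm_time_line hd 0 xy zu zu' l l') st.
move/esym/eqP; rewrite normr_eq0 subr_eq0 => /eqP e.
have zz' : z' = z by move: c c' => /andP[c _] /andP[c' _]; exact: (lr_inj hd c' c e).
by apply/on_light_lineE; exists z; rewrite !pts_ev// zz'; split; left.
Qed.

Lemma sm_time_sym a a' s : sm_time d a a' s -> sm_time d a' a s.
Proof.
move=> st; have := st; case=> [[/on_light_lineE[x [h h']] ->]|[sc _]].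
  by left; split => //; apply/on_light_lineE; exists x.
have [x [y [z [u [z' [u' [[xy zu zu'] aE aE' [l l' _ _]]]]]]]] := strong_causal_line sc.
rewrite aE aE' in st *; apply/(sm_time_line hd _ xy zu' zu l' l).
by rewrite (iffLR (sm_time_line hd _ xy zu zu' l l') st) /line_dist distrC.
Qed.

(** With [lr_le_right] this translates the arc conditions of [between_ev] into inequalities of line
    coordinates: outside [arc z' u'] is the side of [x]. *)
Lemma lr_le_left x y z z' u' : cyc4 x z' y u' -> cyc x z y ->
  ~~ cyc z' z u' -> lr (ld d) x y z <= lr (ld d) x y z'.
Proof.
move=> c h n; have h' : cyc x z' y by case/andP: c.
by rewrite leNgt (lr_lt hd h' h); move: c h n; clear; cyc x z y z' u'.
Qed.

Lemma lr_le_right x y z z' u' : cyc4 x z' y u' -> cyc x z y ->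
  ~~ cyc u' z z' -> lr (ld d) x y z' <= lr (ld d) x y z.
Proof.
move=> c h n; have h' : cyc x z' y by case/andP: c.
by rewrite leNgt (lr_lt hd h h'); move: c h n; clear; cyc x z y z' u'.
Qed.

Lemma sm_time_add a e e' e'' s s' : sm_line d a e -> sm_line d a e' -> sm_line d a e'' ->
  between e e' e'' -> sm_time d e e' s -> sm_time d e' e'' s' -> sm_time d e e'' (s + s').
Proof.
have [x [y [xy ->]]] := event_pair a => l l' l''.
have [z [u [zu eE c h]]] := sm_line_in hd xy l.
have [z' [u' [zu' eE' c' h']]] := sm_line_in hd xy l'.
have [z'' [u'' [zu'' eE'' c'' h'']]] := sm_line_in hd xy l''.
rewrite eE eE' eE'' in l l' l'' *; move=> /(between_ev zu zu' zu'') b.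
move=> /(sm_time_line hd _ xy zu zu' l l') -> /(sm_time_line hd _ xy zu' zu'' l' l'') ->.
apply/(sm_time_line hd _ xy zu zu'' l l''); rewrite /line_dist.
have /andP[m _] := c; have /andP[m'' _] := c''.
case: b => /andP[/andP[b1 _] /andP[b2 _]].
  have i1 := lr_le_left c' m b1; have i2 := lr_le_right c' m'' b2.
  by rewrite !ger0_norm ?subr_ge0 ?(le_trans i1 i2)//; lra.
have i1 := lr_le_right c' m b1; have i2 := lr_le_left c' m'' b2.
by rewrite !ler0_norm ?subr_le0 ?(le_trans i2 i1)//; lra.
Qed.

Lemma sm_time_reach a e s A : sm_line d a e -> 0 < s -> is_arc e A ->
  exists e', [/\ sm_line d a e', arc_cone A e' & sm_time d e e' s].
Proof.
have [x [y [xy ->]]] := event_pair a => l s0.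
have [z [u [zu eE c h]]] := sm_line_in hd xy l.
rewrite eE in l *; move=> /(is_arc_ev _ zu) hA.
(* The event at signed distance [t] from [(z, u)], counted towards [y]. The complement of [arc z u]
   is the closed arc on the side of [x] and is reached with [- s], the other one with [s]. *)
have reach t : exists z' u', [/\ cyc4 x z' y u', z' != u',
    lr (ld d) x y z' = lr (ld d) x y z + t & harm (ld d) x y z' u'].
  have [z' m E] := lm_surj hd (lr (ld d) x y z + t) xy.
  have /and3P[xz' zy' _] := cyc_neq m.
  have [|u' s' h'] := harm_ex hd xy xz'; first by rewrite eq_sym.
  exists z', u'; split => //; last by have /and5P[_ _ _ _ /andP[]] := sep_uniq s'.
  by move: s' m; clear; rewrite /sep; cyc x y z' u'.
have sepc v w : cyc4 x v y w -> sep x y v w by move=> k; rewrite /sep k.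
have /andP[m _] := c.
case: hA => ->.
  have [z' [u' [c' zu' E h']]] := reach (- s).
  have /andP[m' n'] := c'.
  have k : cyc x z' z by rewrite -(lr_lt hd m' m) E; lra.
  have k' : cyc y u u' by rewrite -(harm_rev hd c' c h' h).
  exists (ev z' u'); have l' := in_sm_line hd (sepc _ _ c') h'; split => //.
    apply/(arc_cone_ev _ zu'); split; apply/negP.
      by move: k c; clear; cyc x z' z y u.
    by move: k' c n'; clear; cyc x u' z y u.
  apply/(sm_time_line hd _ xy zu zu' l l').
  by rewrite /line_dist E addrAC subrr add0r normrN gtr0_norm.
have [z' [u' [c' zu' E h']]] := reach s.
have /andP[m' n'] := c'.
have k : cyc x z z' by rewrite -(lr_lt hd m m') E; lra.
have k' : cyc y u' u by rewrite -(harm_rev hd c c' h h').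
exists (ev z' u'); have l' := in_sm_line hd (sepc _ _ c') h'; split => //.
  apply/(arc_cone_ev _ zu'); split; apply/negP.
    by move: k c m'; clear; cyc x z' z y u.
  by move: k' c n'; clear; cyc x u' z y u.
apply/(sm_time_line hd _ xy zu zu' l l').
by rewrite /line_dist E addrAC subrr add0r gtr0_norm.
Qed.

(** Axiom (t5) is the symmetry of the four-term difference in [line_dist] under exchange of its two
    pairs; (t6) equates two such differences by means of the harmonic relation. *)
Lemma sm_timed_causal_axioms :
  timed_causal_axioms (range (sm_line d)) (sm_timeo d) (sm_line d).
Proof.
split.
- by [].
- by move=> e a; exact: sm_line_sep.
- by move=> l a a' [e _ <-]; exact: sm_line_causal.
- by move=> e x; exact: sm_line_at.
- by move=> e a; exact: sm_lineC.
- by move=> a a' l l' ne [e _ <-] [e' _ <-] h1 h2 h3 h4; congr sm_line;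
    exact: (sm_line_perp_uniq hd ne h1 h2 h3 h4).
- move=> e e'; split=> [[s /(sm_timeoE hd)/sm_time_causal//]|/(sm_time_ex hd)[s]].
  by move=> /(sm_timeoE hd); exists s.
- by move=> e e' s /(sm_timeoE hd)/sm_time_ge0.
- by move=> e e'; rewrite (sm_timeoE hd) sm_time0.
- move=> e e'; case E : (sm_timeo d e e') => [s|].
    by apply/esym/(sm_timeoE hd)/sm_time_sym/(sm_timeoE hd).
  case E' : (sm_timeo d e' e) => [s|] //.
  by move: E'; move/(sm_timeoE hd)/sm_time_sym/(sm_timeoE hd); rewrite E.
- move=> a e e' e'' s s' l l' l'' b /(sm_timeoE hd) st /(sm_timeoE hd) st'.
  by apply/(sm_timeoE hd); exact: (sm_time_add l l' l'' b st st').
- move=> a e s A l s0 hA; have [e' [l' eA st]] := sm_time_reach l s0 hA.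
  by exists e'; split => //; apply/(sm_timeoE hd).
- move=> e f x y z u [_ nl] /pair_ofE[xy eE] /pair_ofE[zu fE].
  rewrite eE fE; rewrite eE fE in nl.
  have /and4P[xz xu yz yu] : [&& x != z, x != u, y != z & y != u].
    by apply: contraT => h; case: nl; apply/on_light_line_ev.
  rewrite !(sm_timeo_at hd)// 1?eq_sym//; congr Some.
  rewrite /line_dist /lr; congr `|_|.
  by move: (ld_sym d z x) (ld_sym d z y) (ld_sym d u x) (ld_sym d u y); lra.
- move=> e f a b x y z u ef /pair_ofE[xy eE] /pair_ofE[zu fE] /pair_ofE[xz aE] /pair_ofE[xu bE].
  rewrite eE fE in ef; have [s h] := iffLR (sm_line_ev hd xy zu) ef.
  have /and5P[_ _ _ yz /andP[yu _]] := sep_uniq s.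
  rewrite aE bE !(sm_timeo_at hd)// 1?eq_sym//; congr Some.
  rewrite /line_dist; move: h; rewrite /harm /lr => h.
  have -> : ld d x u - ld d z u - (ld d x y - ld d z y) =
    ld d x z - ld d u z - (ld d x y - ld d u y).
    by move: h (ld_sym d z u) (ld_sym d z y) (ld_sym d u y); lra.
  by [].
Qed.
End TimedCausalSpaceOfSemimetric.

(** * Cross-ratios, inversions and metric balls *)

Section MoebiusClass.
Variable R : realType.
Implicit Types d : semimetric R.
Implicit Types x y z u p q w : S1 R.

Definition lcr d x1 x2 x3 x4 : R :=
  ld d x1 x3 + ld d x2 x4 - (ld d x1 x4 + ld d x2 x3).

Lemma fdist_mul_lt d p q p' q' r s r' s' : p != q -> p' != q' -> r != s -> r' != s' ->
  (fdist d p q * fdist d p' q' < fdist d r s * fdist d r' s') =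
  (ld d p q + ld d p' q' < ld d r s + ld d r' s').
Proof.
move=> h1 h2 h3 h4; rewrite /ld -!lnM ?posrE ?fdist_gt0//.
by rewrite ltr_ln ?posrE ?mulr_gt0 ?fdist_gt0.
Qed.

Lemma cross_ratio_gt0 d x1 x2 x3 x4 : uniq [:: x1; x2; x3; x4] ->
  0 < cross_ratio d x1 x2 x3 x4.
Proof.
rewrite uniq4 => /and5P[_ h13 h14 h23 /andP[h24 _]].
by rewrite /cross_ratio divr_gt0 ?mulr_gt0 ?fdist_gt0.
Qed.

Lemma ln_cross_ratio d x1 x2 x3 x4 : uniq [:: x1; x2; x3; x4] ->
  ln (cross_ratio d x1 x2 x3 x4) = lcr d x1 x2 x3 x4.
Proof.
by rewrite uniq4 => /and5P[_ h13 h14 h23 /andP[h24 _]]; rewrite /cross_ratio ln_quot.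
Qed.

Lemma cross_ratio_lcr d d' x1 x2 x3 x4 y1 y2 y3 y4 :
  uniq [:: x1; x2; x3; x4] -> uniq [:: y1; y2; y3; y4] ->
  cross_ratio d x1 x2 x3 x4 = cross_ratio d' y1 y2 y3 y4 <->
  lcr d x1 x2 x3 x4 = lcr d' y1 y2 y3 y4.
Proof.
move=> U V; rewrite -!ln_cross_ratio//; split=> [->//|/ln_inj]; apply;
  by rewrite posrE cross_ratio_gt0.
Qed.

Lemma moebius_equivP d d' : moebius_equiv d d' <->
  forall x1 x2 x3 x4, uniq [:: x1; x2; x3; x4] -> lcr d x1 x2 x3 x4 = lcr d' x1 x2 x3 x4.
Proof. by split=> h x1 x2 x3 x4 U; have := h _ _ _ _ U; rewrite cross_ratio_lcr. Qed.

(** Each point occurs once in the numerator and once in the denominator of a cross-ratio, so its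
    factor cancels. *)
Lemma moebius_equiv_scale d d' (l : S1 R -> R) :
  (forall x y, x != y -> ld d' x y = ld d x y + l x + l y) -> moebius_equiv d d'.
Proof.
move=> h; apply/moebius_equivP => x1 x2 x3 x4; rewrite uniq4.
by move=> /and5P[_ h13 h14 h23 /andP[h24 _]]; rewrite /lcr !h//; lra.
Qed.

Lemma moebius_equiv_refl d : moebius_equiv d d.
Proof. by []. Qed.

Lemma moebius_equiv_sym d d' : moebius_equiv d d' -> moebius_equiv d' d.
Proof. by move=> h x1 x2 x3 x4 U; rewrite h. Qed.

Lemma moebius_equiv_trans d d' d'' :
  moebius_equiv d d' -> moebius_equiv d' d'' -> moebius_equiv d d''.
Proof. by move=> h h' x1 x2 x3 x4 U; rewrite h// h'. Qed.

Definition moebius_of d : moebius R := Moebius (ex_intro _ d erefl).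

Lemma moebius_ofP (M : moebius R) d : M d -> M = moebius_of d.
Proof.
case: M => C P /= Cd; have CE : C = moebius_equiv d.
  case: (P) => d0 CE; rewrite CE in Cd; apply/funext => d'; apply/propext; rewrite CE.
  split; first exact/moebius_equiv_trans/moebius_equiv_sym.
  exact: moebius_equiv_trans.
by subst C; rewrite /moebius_of; congr Moebius; exact: Prop_irrelevance.
Qed.

Lemma moebius_ex (M : moebius R) : exists d, M d.
Proof. by case: M => C [d0 CE] /=; exists d0; rewrite CE. Qed.

Section Inversion.
Variables (d : semimetric R) (w : S1 R).

(* The semi-metric of the class of d with infinitely remote point w. *)
Definition inv_dist x y : \bar R :=
  if x == y then 0%E else if (x == w) || (y == w) then +oo%E else
  (fdist d x y / (fdist d x w * fdist d y w))%:E.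

Lemma inv_semimetric : is_semimetric inv_dist.
Proof.
have oo x y : inv_dist x y = +oo%E -> x = w \/ y = w.
  rewrite /inv_dist; case: eqP => // _; case: eqP => [->|_]; first by left.
  by case: eqP => [->|_] //; right.
have rem : inf_remote inv_dist w.
  by move=> x xw; rewrite /inv_dist (negbTE xw) eqxx orbT.
split.
- by move=> x y; rewrite /inv_dist eq_sym orbC fdist_sym (mulrC (fdist d x w)).
- by move=> x; rewrite /inv_dist eqxx.
- move=> x y xy; rewrite /inv_dist (negbTE xy); case: ifPn => // /norP[xw yw].
  by rewrite lte_fin divr_gt0 ?mulr_gt0 ?fdist_gt0.
- by move=> x y /oo[] ->; [left|right].
- move=> v v' hv hv'; have inf v'' : inf_remote inv_dist v'' -> v'' = w.
    move=> h; have [z zv zw] := exists_neq2 v'' w.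
    by case: (oo _ _ (h z zv)) => // e; rewrite e eqxx in zw.
  by rewrite (inf v)// (inf v').
Qed.

Definition inversion : semimetric R := Semimetric inv_semimetric.

Lemma inversion_remote : inf_remote inversion w.
Proof. by move=> x xw; rewrite /= /inv_dist (negbTE xw) eqxx orbT. Qed.

(** The inversion is a rescaling of [d]; the convention that infinite distances have logarithm 0
    lets the same formula cover the remote point. *)
Lemma ld_inversion x y : x != y -> ld inversion x y =
  ld d x y + (if x == w then 0 else - ld d x w) + (if y == w then 0 else - ld d y w).
Proof.
move=> xy; rewrite {1}/ld {1}/fdist /= /inv_dist (negbTE xy).
have [xw|xw] /= := eqVneq x w.
  subst x; rewrite eq_sym (negbTE xy) ln1 (ld_sym d w); lra.
have [yw|yw] /= := eqVneq y w; first by subst y; rewrite ln1; lra.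
rewrite ln_div ?posrE ?mulr_gt0 ?fdist_gt0// lnM ?posrE ?fdist_gt0// /ld; lra.
Qed.

Lemma inversion_equiv : moebius_equiv d inversion.
Proof. exact: moebius_equiv_scale ld_inversion. Qed.

Lemma lr_inversion x y : x != w -> y != x -> y != w ->
  lr (ld inversion) x w y = lr (ld d) x w y - ld d x w.
Proof.
move=> xw yx yw; have wy : w != y by rewrite eq_sym.
have xy : x != y by rewrite eq_sym.
by rewrite /lr !ld_inversion// (negbTE xw) eqxx; lra.
Qed.

End Inversion.

Lemma log_moebius_equiv d d' : moebius_equiv d d' ->
  log_moebius (ld d) -> log_moebius (ld d').
Proof.
move=> /moebius_equivP e h; split.
- exact: ld_sym.
- move=> x y z u c; have U : uniq [:: x; u; y; z].
    by rewrite uniq4; move: c; clear; cyc x y z u.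
  have := e _ _ _ _ U; rewrite /lcr.
  have := lm_mono h c; rewrite !(ld_sym _ u); lra.
- move=> p w s pw; have [y0 h0 _] := lm_surj h 0 pw.
  (* Equal cross-ratios make the functions [lr] of [d'] and [d] differ by a constant on the arc. The
     point [y0] reads off this constant, by which the required value is shifted. *)
  have [y hy E] := lm_surj h (s - (ld d' p y0 - ld d' w y0) + (ld d p y0 - ld d w y0)) pw.
  exists y => //; have [yE|yy0] := eqVneq y y0.
    by rewrite yE in E *; lra.
  have U : uniq [:: p; w; y; y0].
    by rewrite uniq4; move: yy0 h0 hy; clear; cyc p w y y0.
  by have := e _ _ _ _ U; rewrite /lcr; lra.
Qed.

(** Since [ld d w y] vanishes for the remote point [w], [lr] is the logarithm of the distance from
    [x]. The centre, at distance 0, is listed apart. *)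
Lemma ball_lr d w x y (r : R) : inf_remote d w -> x != w -> 0 < r ->
  (d x y < r%:E)%E <-> y != w /\ (y = x \/ lr (ld d) x w y < ln r).
Proof.
move=> dw xw r0; have [->|yw] := eqVneq y w.
  by rewrite (dw _ xw); split=> // -[].
have [->|yx] := eqVneq y x.
  by rewrite (sm_diag (sm_distP d)) lte_fin; split => //; split => //; left.
have fin z v : z != w -> v != w -> d z v != +oo%E.
  move=> zw vw; apply/eqP => /(sm_inf (sm_distP d)).
  by case=> h; have e := sm_inf_uniq (sm_distP d) h dw; rewrite e eqxx in zw vw.
have lw : ld d w y = 0 by rewrite ld_sym /ld /fdist (dw _ yw) ln1.
have dE : d x y = (fdist d x y)%:E.
  have := fin _ _ xw yw; have : (0 < d x y)%E by apply: (sm_pos (sm_distP d)); rewrite eq_sym.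
  by rewrite /fdist; case: (sm_dist d x y).
have f0 : 0 < fdist d x y by rewrite fdist_gt0// eq_sym.
rewrite dE lte_fin /lr lw subr0 /ld ltr_ln ?posrE//; split=> [h|[_ [e|//]]].
  by split => //; right.
by rewrite e eqxx in yx.
Qed.

End MoebiusClass.

(** * Monotone Möbius structures as logarithmic ones *)

Section MonotoneMoebius.
Variable R : realType.
Implicit Types d : semimetric R.
Implicit Types x y z u p q w : S1 R.

Lemma open_separated (T : topologicalType) (A B : set T) :
  open A -> open B -> A `&` B = set0 -> separated A B.
Proof.
move=> oA oB AB; have gen (C D : set T) : open D -> C `&` D = set0 -> closure C `&` D = set0.
  move=> oD CD; rewrite -subset0 => x [Cx Dx].
  by have := Cx D (open_nbhs_nbhs (conj oD Dx)); rewrite CD => -[].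
by split; [exact: gen|rewrite setIC gen// setIC].
Qed.

Lemma ball_open_surj d : (forall w x (r : R), x != w -> 0 < r ->
    open [set y | (inversion d w x y < r%:E)%E]) ->
  forall p w (s : R), p != w -> exists2 y, cyc p y w & ld d p y - ld d w y = s.
Proof.
move=> bo p w s pw; pose U q v (t : R) := [set y | y != v /\ (y = q \/ lr (ld d) q v y < t)].
have Uo q v t : q != v -> open (U q v t).
  move=> qv.
  have -> : U q v t = [set y | (inversion d v q y < (expR (t - ld d q v))%:E)%E].
    apply/seteqP; split=> y /=; rewrite (ball_lr _ (@inversion_remote _ d v) qv) ?expR_gt0// expRK.
      move=> [yv h]; split => //; have [->|yq] := eqVneq y q; first by left.
      by case: h => [e|h]; [left|right; rewrite lr_inversion//; lra].
    move=> [yv h]; split => //; have [->|yq] := eqVneq y q; first by left.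
    by case: h => [e|]; [left|rewrite lr_inversion// => h; right; lra].
  by apply: bo => //; exact: expR_gt0.
have wp : w != p by rewrite eq_sym.
apply: contrapT => nex.
(* On [A] the function [lr] is below [s], on [B] above it. If [s] were skipped, they would
   disconnect the arc: neither is empty, as a ball about an end point meets the arc. *)
pose A := arc p w `&` U p w s; pose B := arc p w `&` U w p (- s).
have AB0 : A `&` B = set0.
  rewrite -subset0 => y [[pyw [_ h1]] [_ [_ h2]]].
  move: h1 h2; have /and3P[py yw _] := cyc_neq pyw.
  case=> [e|h1]; first by rewrite e eqxx in py.
  case=> [e|h2]; first by rewrite e eqxx in yw.
  by move: h1 h2; rewrite /lr; lra.
have cover : arc p w `<=` A `|` B.
  move=> y pyw; have /and3P[py yw _] := cyc_neq pyw.
  have [h|h|e] := ltgtP (lr (ld d) p w y) s.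
  - by left; split => //; split => //; right.
  - by right; split => //; split; [rewrite eq_sym|right; rewrite lrC ltrN2].
  - by case: nex; exists y.
have oA : open A by apply: openI; [exact: arc_open|exact: Uo].
have oB : open B by apply: openI; [exact: arc_open|exact: Uo].
have meet q v t : q != v -> closure (arc p w) q -> exists2 y, arc p w y & U q v t y.
  move=> qv cl; have [|y [h1 h2]] := cl (U q v t); last by exists y.
  by apply: open_nbhs_nbhs; split; [exact: Uo|split => //; left].
have clp : closure (arc p w) p by rewrite closure_arc// /arc /= cycxyy.
have clw : closure (arc p w) w by rewrite closure_arc// /arc /= cycxxy.
have [y1 h1 k1] := meet p w s pw clp; have [y2 h2 k2] := meet w p (- s) wp clw.
have [h|h] := connected_subset (open_separated oA oB AB0) cover (@arc_connected _ _ _).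
  have : (A `&` B) y2 by split; [exact: h|].
  by rewrite AB0.
have : (A `&` B) y1 by split; [|exact: h].
by rewrite AB0.
Qed.

Lemma monotone_log_moebius (M : moebius R) d : is_monotone M -> M d -> log_moebius (ld d).
Proof.
move=> [MT MM] Md; split.
- exact: ld_sym.
- move=> x y z u c; have /and5P[xy xz xu yz /andP[yu zu]] := cyc4_neq c.
  have S : separate (ev x z) (ev y u) by apply/separate_ev => //; rewrite /sep c.
  have := MM d _ _ _ _ _ _ Md S (pair_of_ev xz) (pair_of_ev yu).
  rewrite gt_max => /andP[h _]; move: h.
  by rewrite fdist_mul_lt.
- apply: ball_open_surj => w x r xw r0; rewrite -MT.
  set B := [set y | _]; exists [set B]; last by rewrite bigcup_set1.
  move=> _ ->; apply: (@finI_from1 _ _ (moebius_balls M) id B).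
  exists (inversion d w), w, x, r; split => //; last exact: inversion_remote.
  have ME := moebius_ofP Md; rewrite ME; exact: inversion_equiv.
Qed.

Lemma log_moebius_monotone (M : moebius R) d : M d -> log_moebius (ld d) -> is_monotone M.
Proof.
move=> Md hd; have ME := moebius_ofP Md.
have hM d' : M d' -> log_moebius (ld d').
  by rewrite ME => e; exact: log_moebius_equiv e hd.
split.
  apply/seteqP; split=> [_ [D DB <-]|U oU].
    apply: bigcup_open => B /DB[F FB <-].
    rewrite bigcap_fset big_seq; apply: big_ind => [||C CF]; first exact: openT.
      exact: openI.
    have /set_mem := FB _ CF; move=> [d' [w [x [r [/hM hd' dw xw r0 CE]]]]].
    (* The points [a] and [b] lie at distance [r] from [x] on its two sides, so the ball is the arc
       from [b] to [a]. *)
    have [a ha Ea] : exists2 a, cyc x a w & lr (ld d') x w a = ln r.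
      exact: (lm_surj hd').
    have [b hb Eb] : exists2 b, cyc w b x & lr (ld d') w x b = - ln r.
      by apply: (lm_surj hd'); rewrite eq_sym.
    rewrite CE; suff -> : [set y | (d' x y < r%:E)%E] = arc b a by exact: arc_open.
    apply/seteqP; split=> y /=; rewrite (ball_lr _ dw xw r0) /arc /=.
      move=> [yw [->|h]]; first by move: ha hb; clear; cyc w a b x.
      have [->|yx] := eqVneq y x; first by move: ha hb; clear; cyc w a b x.
      case: (boolP (cyc x y w)) => hy.
        have : cyc x y a by rewrite -(lr_lt hd' hy ha) Ea.
        by move: ha hb hy; clear; cyc w a b x y.
      have {}hy : cyc w y x by move: hy yx yw xw; clear; cyc w x y.
      have : cyc w b y by rewrite -(lr_lt hd' hb hy) Eb lrC; lra.
      by move: ha hb hy; clear; cyc w a b x y.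
    move=> hy; have yw : y != w by move: ha hb hy; clear; cyc w a b x y.
    split => //; have [->|yx] := eqVneq y x; first by left.
    right; case: (boolP (cyc x y w)) => hy'.
      rewrite -Ea (lr_lt hd' hy' ha); by move: ha hb hy hy'; clear; cyc w a b x y.
    have {}hy' : cyc w y x by move: hy' yx yw xw; clear; cyc w x y.
    have : lr (ld d') w x b < lr (ld d') w x y.
      by rewrite (lr_lt hd' hb hy'); move: ha hb hy hy'; clear; cyc w a b x y.
    by rewrite Eb (lrC _ x w); lra.
  exists [set B | finI_from (moebius_balls M) id B /\ B `<=` U]; first by move=> B [].
  apply/seteqP; split=> [x [B [_ BU] /BU//]|x Ux].
  have [a [b [axb abU]]] := open_arc oU Ux.
  have [w bwa] : exists w, cyc b w a by apply: arc_ex; move: axb; clear; cyc a b x.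
  have xw : x != w by move: axb bwa; clear; cyc a b x w.
  have Md' : M (inversion d w) by rewrite ME; exact: inversion_equiv.
  have hd' := hM _ Md'; have dw := @inversion_remote _ d w.
  set L := lr (ld (inversion d w)) x w.
  (* With the remote point [w] outside the arc from [a] to [b], a ball about [x] whose logarithmic
     radius is at most [L a] and [L b] stays inside this arc. *)
  have [t ta tb] : exists2 t, t <= L a & t <= L b.
    by case: (leP (L a) (L b)) => h; [exists (L a)|exists (L b) => //; apply: ltW].
  exists [set y | (inversion d w x y < (expR t)%:E)%E]; last first.
    by apply/(ball_lr _ dw xw (expR_gt0 _)); split => //; left.
  split.
    apply: (@finI_from1 _ _ (moebius_balls M) id).
    by exists (inversion d w), w, x, (expR t); split => //; exact: expR_gt0.
  move=> y /(ball_lr _ dw xw (expR_gt0 _)); rewrite expRK => -[yw h]; apply: abU.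
  have [->//|yx] := eqVneq y x; case: h => [e|h]; first by rewrite e eqxx in yx.
  rewrite /arc /=; case: (boolP (cyc x y w)) => hy.
    have hb : cyc x b w by move: axb bwa; clear; cyc a b x w.
    have : cyc x y b by rewrite -(lr_lt hd' hy hb); exact: lt_le_trans tb.
    by move: axb bwa hy; clear; cyc x y a b w.
  have {}hy : cyc w y x by move: hy yx yw xw; clear; cyc w x y.
  have ha : cyc w a x by move: axb bwa; clear; cyc a b x w.
  have : cyc w a y.
    by rewrite -(lr_lt hd' ha hy) !(lrC _ x w) ltrN2; exact: lt_le_trans ta.
  by move: axb bwa hy; clear; cyc x y a b w.
move=> d' e a x y z u /hM hd' S /pair_ofE[xy eE] /pair_ofE[zu aE].
rewrite eE aE in S; move/(separate_ev xy zu): S => S.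
have /and5P[_ xz xu yz /andP[yu _]] := sep_uniq S.
rewrite gt_max !fdist_mul_lt//.
move: (ld_sym d' x z) (ld_sym d' x u) (ld_sym d' y z) (ld_sym d' y u).
move: (ld_sym d' z u) (ld_sym d' x y).
case/orP: S => c.
  have c' : cyc4 z y u x by move: c; clear; cyc x y z u.
  by have := lm_mono hd' c; have := lm_mono hd' c'; lra.
have c' : cyc4 u y z x by move: c; clear; cyc x y z u.
by have := lm_mono hd' c; have := lm_mono hd' c'; lra.
Qed.

End MonotoneMoebius.

(** * Time on the lines of an abstract timed causal space *)

Section TimeFunction.
Variable R : realType.
Variable H : set (set (event R)).
Variable t : event R -> event R -> option R.
Variable h : event R -> set (event R).
Hypothesis hT : timed_causal_axioms H t h.
Implicit Types x y z u v p q w a b c e : S1 R.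

Lemma h_sep x y z u : x != y -> z != u -> h (ev x y) (ev z u) -> sep x y z u.
Proof. by move=> xy zu /(tc_h2 hT)/(separate_ev zu xy); rewrite sep_swap. Qed.

Lemma h_in (f : event R) : H (h f).
Proof. by rewrite (tc_h1 hT); exists f. Qed.

Lemma notin_ev x y z : x != y -> x != z -> y != z -> ~ pts (ev x y) z.
Proof. by move=> xy xz yz; rewrite pts_ev// => -[] e; rewrite e eqxx in xz yz. Qed.

Lemma h_ex x y z : x != y -> x != z -> y != z ->
  exists2 u, sep x y z u & h (ev x y) (ev z u).
Proof.
move=> xy xz yz; have [f [[hf fz] _]] := tc_h4 hT (notin_ev xy xz yz).
have [u zu fE] := event_pt fz; rewrite fE in hf.
by exists u => //; exact: h_sep.
Qed.

Lemma h_uniq x y z u u' : sep x y z u -> h (ev x y) (ev z u) ->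
  sep x y z u' -> h (ev x y) (ev z u') -> u = u'.
Proof.
move=> s k s' k'; have /and5P[xy xz _ yz /andP[_ zu]] := sep_uniq s.
have /and5P[_ _ _ _ /andP[_ zu']] := sep_uniq s'.
have [f [_ fU]] := tc_h4 hT (notin_ev xy xz yz).
have e : ev z u = ev z u'.
  by rewrite -(fU (ev z u)) ?(fU (ev z u'))//; split => //; rewrite pts_ev//; left.
by case: (ev_inj zu zu' e) => [[]//|[e1 e2]]; rewrite -e1 eqxx in zu'.
Qed.

Lemma event_at_h x y z u : sep x y z u -> h (ev x y) (ev z u) ->
  event_at h (ev x y) z = ev z u.
Proof.
move=> s k; have /and5P[xy xz _ yz /andP[_ zu]] := sep_uniq s.
apply: event_atE => //; last by rewrite pts_ev//; left.
exact: (tc_h4 hT (notin_ev xy xz yz)).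
Qed.

(* The time between the events of the line of (x, y) through z and u. *)
Definition line_time x y z u : R :=
  odflt 0 (t (event_at h (ev x y) z) (event_at h (ev x y) u)).
Local Notation tv := line_time.

Lemma tv_Some x y z u : x != y -> x != z -> y != z -> x != u -> y != u ->
  t (event_at h (ev x y) z) (event_at h (ev x y) u) = Some (tv x y z u).
Proof.
move=> xy xz yz xu yu; rewrite /line_time.
have [z' s k] := h_ex xy xz yz; have [u' s' k'] := h_ex xy xu yu.
rewrite (event_at_h s k) (event_at_h s' k').
by have [r ->] := iffRL (tc_t1_def hT _ _) (tc_h3 hT (h_in _) k k').
Qed.

Lemma tv_eq x y z z' u u' r : sep x y z z' -> h (ev x y) (ev z z') ->
  sep x y u u' -> h (ev x y) (ev u u') ->
  t (ev z z') (ev u u') = Some r <-> tv x y z u = r.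
Proof.
move=> s k s' k'; have /and5P[xy xz _ yz _] := sep_uniq s.
have /and5P[_ xu _ yu _] := sep_uniq s'.
rewrite -(event_at_h s k) -(event_at_h s' k') tv_Some//.
by split=> [[]|->].
Qed.

Lemma tvCl x y z u : tv x y z u = tv y x z u.
Proof. by rewrite /line_time evC. Qed.

Lemma tvCr x y z u : tv x y z u = tv x y u z.
Proof. by rewrite /line_time (tc_t3 hT). Qed.

Lemma tv_conj x y z z' u : sep x y z z' -> h (ev x y) (ev z z') ->
  tv x y z u = tv x y z' u.
Proof.
move=> s k; have s' : sep x y z' z by rewrite sepCr.
have k' : h (ev x y) (ev z' z) by rewrite (evC z').
by rewrite /line_time (event_at_h s k) (event_at_h s' k') (evC z').
Qed.

Lemma tv_ge0 x y z u : 0 <= tv x y z u.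
Proof.
by rewrite /line_time; case E: (t _ _) => [r|] //=; exact: (tc_t1_ge0 hT E).
Qed.

(** By (t2), time 0 would make the two events of the line share a point. By (h4) they would then
    coincide, but [z] and [u] are different points on the same side of [(x, y)]. *)
Lemma tv_gt0 x y z u : cyc x z y -> cyc x u y -> z != u -> 0 < tv x y z u.
Proof.
move=> xzy xuy zu; rewrite lt_neqAle tv_ge0 andbT eq_sym; apply/eqP => t0.
have /and3P[xz zy xy] := cyc_neq xzy; have /and3P[xu uy _] := cyc_neq xuy.
have yz : y != z by rewrite eq_sym.
have yu : y != u by rewrite eq_sym.
have := tv_Some xy xz yz xu yu; rewrite t0.
have [z' s k] := h_ex xy xz yz; have [u' s' k'] := h_ex xy xu yu.
have /and5P[_ _ _ _ /andP[_ zz']] := sep_uniq s.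
have /and5P[_ _ _ _ /andP[_ uu']] := sep_uniq s'.
rewrite (event_at_h s k) (event_at_h s' k') => /(tc_t2 hT)/(on_light_line_ev zz' uu')/negP.
apply; rewrite zu /=.
have zu' : z != u' by move: xzy xuy s'; clear; rewrite /sep; cyc x y z u u'.
have z'u : z' != u by move: xzy xuy s; clear; rewrite /sep; cyc x y z u z'.
rewrite zu' z'u /=; apply/eqP => e; rewrite -e in s' k'.
have t' : sep x y z' z by rewrite sepCr.
have l' : h (ev x y) (ev z' z) by rewrite (evC z').
have t'' : sep x y z' u by rewrite sepCr.
have l'' : h (ev x y) (ev z' u) by rewrite (evC z').
by rewrite (h_uniq t' l' t'' l'') eqxx in zu.
Qed.

Lemma tv_self x y z : x != y -> x != z -> y != z -> tv x y z z = 0.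
Proof.
move=> xy xz yz; have := tv_Some xy xz yz xz yz.
have [z' s k] := h_ex xy xz yz; rewrite (event_at_h s k).
by move: (iffRL (tc_t2 hT _ _) (@on_light_refl R (ev z z'))) => -> [].
Qed.

Lemma h_nonsep x y z z' u u' : sep x y z z' -> h (ev x y) (ev z z') ->
  sep x y u u' -> h (ev x y) (ev u u') -> ~~ sep z z' u u'.
Proof.
move=> s k s' k'; have /and5P[_ _ _ _ /andP[_ zz']] := sep_uniq s.
have /and5P[_ _ _ _ /andP[_ uu']] := sep_uniq s'.
by apply/(causal_ev zz' uu'); exact: (tc_h3 hT (h_in _) k k').
Qed.

Lemma h_ex_cyc4 x v y : cyc x v y -> exists v',
  [/\ cyc4 x v y v', sep x y v v', v != v' & h (ev x y) (ev v v')].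
Proof.
move=> k; have /and3P[xv vy xy] := cyc_neq k.
have [|v' s hv] := h_ex xy xv; first by rewrite eq_sym.
exists v'; split => //; last by have /and5P[_ _ _ _ /andP[]] := sep_uniq s.
by move: k s; clear; rewrite /sep; cyc x y v v'.
Qed.

(** By (h3) the events of the line do not separate each other, so their far ends come weakly in the
    reverse order. This is the betweenness required by (t4). *)
Lemma tv_add x y z z' z'' : cyc x z z' -> cyc x z' z'' -> cyc x z'' y ->
  tv x y z z'' = tv x y z z' + tv x y z' z''.
Proof.
move=> c1 c2 c3.
have m'' : cyc x z'' y by [].
have m' : cyc x z' y by move: c2 c3; clear; cyc x y z' z''.
have m : cyc x z y by move: c1 m'; clear; cyc x y z z'.
have [u [k s zu l]] := h_ex_cyc4 m; have [u' [k' s' zu' l']] := h_ex_cyc4 m'.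
have [u'' [k'' s'' zu'' l'']] := h_ex_cyc4 m''.
apply/(tv_eq _ s l s'' l'').
have e1 : t (ev z u) (ev z' u') = Some (tv x y z z') by apply/(tv_eq _ s l s' l').
have e2 : t (ev z' u') (ev z'' u'') = Some (tv x y z' z'') by apply/(tv_eq _ s' l' s'' l'').
apply: (tc_t4a hT l l' l'' _ e1 e2); apply/(between_ev zu zu' zu''); left.
have n := h_nonsep s l s' l'; have n' := h_nonsep s'' l'' s' l'.
have xyu' : cyc x y u' by case/andP: k'.
apply/andP; split.
  have zz' : cyc4 x z z' y by rewrite /cyc4 c1.
  have uu' : cyc x u' u || (u' == u).
    by move: n k zz' xyu'; clear; rewrite /sep; cyc x y z u z' u'.
  case/andP: zz' => zz1 zz2; case/andP: k => _ xyu.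
  apply/andP; split; first by move: c1 m' xyu'; clear; cyc x y z z' u'.
  by move: m' xyu' uu'; clear; cyc x y z' u u'.
have uu' : cyc x u'' u' || (u' == u'').
  by move: n' k'' c2 c3 xyu'; clear; rewrite /sep; cyc x y z'' u'' z' u'.
case/andP: k'' => _ xyu''.
apply/andP; split; first by move: c2 c3 xyu'; clear; cyc x y z' z'' u'.
by move: m' xyu'' xyu' uu'; clear; cyc x y z' u' u''.
Qed.

End TimeFunction.

(** * Time as a function of pairs of arcs, and coordinates on lines *)

Section SemimetricOfTime.
Variable R : realType.
Variable H : set (set (event R)).
Variable t : event R -> event R -> option R.
Variable h : event R -> set (event R).
Hypothesis hT : timed_causal_axioms H t h.
Implicit Types x y z u v p q w a b c e : S1 R.
Local Notation tv := (line_time t h).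

(** Part (b) of (t4) in terms of points: [p] is the end, on the arc from [x] to [y], of the event
    which that axiom provides. *)
Lemma tv_reach_arc x y z u s A : cyc4 x z y u -> h (ev x y) (ev z u) ->
  0 < s -> is_arc (ev z u) A ->
  exists p, [/\ cyc x p y, A p, p != z & tv x y z p = s].
Proof.
move=> c k s0 hA; have sz : sep x y z u by rewrite /sep c.
have [e' [he' Ae' te']] := tc_t4b hT k s0 hA.
have [p [q [pq eE]]] := event_pair e'; rewrite eE in he' Ae' te'.
have /and5P[xy _ _ _ _] := sep_uniq sz.
have sp := h_sep hT xy pq he'.
have /(arc_cone_ev _ pq)[Ap Aq] := Ae'.
have tp := iffLR (tv_eq hT s sz k sp he') te'.
have nz v v' : sep x y v v' -> tv x y z v = s -> v != z.
  move=> /sep_uniq/and5P[_ _ _ _ _] E; apply/eqP => vz.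
  have /and5P[_ xz _ yz _] := sep_uniq sz.
  by move: s0; rewrite -E vz (tv_self hT) ?ltxx.
case/orP: (sp) => c'.
  by exists p; case/andP: (c') => ? _; split => //; exact: nz sp tp.
have sq : sep x y q p by rewrite sepCr.
have tq : tv x y z q = s.
  rewrite (tvCr hT) (@tv_conj _ _ _ _ hT x y q p z)//; last by rewrite (evC q).
  by rewrite (tvCr hT).
by exists q; case/andP: (c') => ? _; split => //; exact: nz sq tq.
Qed.

Lemma tv_reach_right x y z s : cyc x z y -> 0 < s ->
  exists p, [/\ cyc x z p, cyc x p y & tv x y z p = s].
Proof.
move=> c s0; have [u [c4 sz zu k]] := h_ex_cyc4 hT c.
have [|p [xpy Ap pz tp]] := @tv_reach_arc x y z u s (~` arc u z) c4 k s0.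
  by apply/(is_arc_ev _ zu); right.
exists p; split => //; have /negP np : ~ cyc u p z := Ap.
by move: np c4 xpy pz; clear; cyc x y z u p.
Qed.

Lemma tv_reach_left x y z s : cyc x z y -> 0 < s ->
  exists2 p, cyc x p z & tv x y z p = s.
Proof.
move=> c s0; have [u [c4 sz zu k]] := h_ex_cyc4 hT c.
have [|p [xpy Ap pz tp]] := @tv_reach_arc x y z u s (~` arc z u) c4 k s0.
  by apply/(is_arc_ev _ zu); left.
exists p => //; have /negP np : ~ cyc z p u := Ap.
by move: np c4 xpy pz; clear; cyc x y z u p.
Qed.

(** Axiom (t5), read as symmetry in the disjoint arcs from [a] to [b] and from [c] to [e]. *)
Lemma tv_swap a b c e : cyc4 a b c e -> tv a b c e = tv c e a b.
Proof.
move=> k; have /and5P[ab ac ae bc /andP[be ce]] := cyc4_neq k.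
have sc : strong_causal (ev a b) (ev c e).
  split; first by apply/(causal_ev ab ce); move: k; clear; rewrite /sep; cyc a b c e.
  by move=> /(on_light_line_ev ab ce); rewrite ac ae bc be.
by rewrite /line_time (tc_t5 hT sc (pair_of_ev ab) (pair_of_ev ce)).
Qed.

Lemma tv_perp x y z u : sep x y z u -> h (ev x y) (ev z u) -> tv x z y u = tv x u y z.
Proof.
move=> s k; have /and5P[xy xz xu _ /andP[_ zu]] := sep_uniq s.
rewrite /line_time.
by rewrite (tc_t6 hT k (pair_of_ev xy) (pair_of_ev zu) (pair_of_ev xz) (pair_of_ev xu)).
Qed.

Lemma tv_add4 a b c e f : cyc4 a b c e -> cyc a e f -> tv a b c f = tv a b c e + tv a b e f.
Proof.
move=> k1 k2; rewrite !(tvCl t h a b); apply: (tv_add hT).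
- by move: k1; clear; cyc a b c e.
- by move: k1 k2; clear; cyc a b c e f.
- by move: k1 k2; clear; cyc a b c e f.
Qed.

(* A coordinate on the line of (x, w), increasing towards w, pulled back to the
   points of the circle. *)
Lemma line_coord x w : exists phi : S1 R -> R, x != w ->
  [/\ forall y y', cyc x y y' -> cyc x y' w -> phi y' - phi y = tv x w y y',
      forall y y', sep x w y y' -> h (ev x w) (ev y y') -> phi y = phi y' &
      forall y y', cyc w y' y -> cyc w y x -> phi y' - phi y = tv x w y y'].
Proof.
have [->|xw] := eqVneq x w; first by exists (fun=> 0).
have [b xbw] := arc_ex xw.
(* [r v] is the signed time from the origin [b] on the arc from [x] to [w]. A point of the opposite
   arc is first replaced by the other end [cj y] of its event. *)
pose r v := if cyc x b v then tv x w b v else - tv x w b v.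
pose cj y := xget y [set u | sep x w y u /\ h (ev x w) (ev y u)].
have /and3P[xb bw _] := cyc_neq xbw; have wb : w != b by rewrite eq_sym.
have rb : r b = 0 by rewrite /r cycxyy (tv_self hT)// oppr0.
have rD y y' : cyc x y y' -> cyc x y' w -> r y' - r y = tv x w y y'.
  move=> c1 c2; have [yb|yb] := eqVneq y b.
    by rewrite yb rb subr0 /r -yb c1.
  have [yb'|yb'] := eqVneq y' b.
    rewrite yb' rb sub0r /r -yb' (negbTE (cyc_asym c1)) opprK (tvCr hT).
    by [].
  have [k|k] := boolP (cyc x b y).
    have k' : cyc x b y' by move: k c1; clear; cyc x b y y'.
    by rewrite /r k k' (tv_add hT k c1 c2); lra.
  have yxb : cyc x y b by move: k yb xb c1 c2 xbw; clear; cyc x b y y' w.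
  have [k'|k'] := boolP (cyc x b y').
    rewrite /r (negbTE k) k' (tv_add hT yxb k' c2) (tvCr hT x w b y); lra.
  have y'xb : cyc x y' b by move: k' yb' xb c1 c2 xbw; clear; cyc x b y y' w.
  rewrite /r (negbTE k) (negbTE k') !(tvCr hT x w b) (tv_add hT c1 y'xb xbw); lra.
have cjP y : x != y -> w != y -> sep x w y (cj y) /\ h (ev x w) (ev y (cj y)).
  move=> xy wy; rewrite /cj; case: xgetP => [u _ //|/=].
  by have [u s k] := h_ex hT xw xy wy => /(_ u) [].
pose phi y := r (if cyc x y w then y else cj y).
have phi_cj y y' : sep x w y y' -> h (ev x w) (ev y y') -> phi y = phi y'.
  move=> s k; have s' : sep x w y' y by rewrite sepCr.
  have k' : h (ev x w) (ev y' y) by rewrite (evC y').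
  have /and5P[_ xy xy' wy /andP[wy' _]] := sep_uniq s.
  have [s1 k1] := cjP y xy wy; have [s2 k2] := cjP y' xy' wy'.
  rewrite /phi -(h_uniq hT s k s1 k1) -(h_uniq hT s' k' s2 k2).
  have -> : cyc x y' w = ~~ cyc x y w by apply/idP/idP; move: s; clear; rewrite /sep; cyc x w y y'.
  by case: (cyc x y w).
have phi1 y y' : cyc x y y' -> cyc x y' w -> phi y' - phi y = tv x w y y'.
  move=> c1 c2; have c3 : cyc x y w by move: c1 c2; clear; cyc x y y' w.
  by rewrite /phi c2 c3; exact: rD.
exists phi => _; split => // y y' c1 c2.
have c3 : cyc w y' x by move: c1 c2; clear; cyc w x y y'.
have [v [c sv nv kv]] := h_ex_cyc4 hT c2; have [v' [c' sv' nv' kv']] := h_ex_cyc4 hT c3.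
have {}sv : sep x w y v by rewrite sepCl.
have {}kv : h (ev x w) (ev y v) by rewrite (evC x).
have {}sv' : sep x w y' v' by rewrite sepCl.
have {}kv' : h (ev x w) (ev y' v') by rewrite (evC x).
rewrite (phi_cj _ _ sv kv) (phi_cj _ _ sv' kv') (tv_conj hT _ sv kv).
rewrite (tvCr hT) (tv_conj hT _ sv' kv') (tvCr hT); apply: phi1.
  have n := h_nonsep hT sv kv sv' kv'.
  have vv' : v != v'.
    apply/eqP => e; subst v'.
    have e1 : sep x w v y by rewrite sepCr.
    have e2 : sep x w v y' by rewrite sepCr.
    have := h_uniq hT e1 _ e2; rewrite !(evC v) => /(_ kv kv') e.
    by rewrite e cycxyy in c1.
  by move: n c c' c1 vv'; clear; rewrite /sep; cyc x w y y' v v'.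
by move: c'; clear; cyc w y' x v'.
Qed.

(** The left-hand side collects the times of the arc from [x] to [x'] against the arcs from [p] to
    [w] ([e1]) and from [y] to [p] ([e2]); these two arcs join to the one from [y] to [w] ([e3]). *)
Lemma time_increment w x x' y p : cyc4 w x y p -> cyc w x x' -> cyc4 w x' y p ->
  tv p w y x - tv x w y p - (tv p w y x' - tv x' w y p) = tv y w x' x.
Proof.
move=> k c k'; have k2 : cyc4 x x' y p by move: k k' c; clear; cyc w x x' y p.
have e1 : tv p w y x = tv p w y x' + tv p w x' x.
  rewrite (tvCr hT _ _ y x) (tvCr hT _ _ y x') (tvCr hT _ _ x' x) !(tvCl t h p w).
  rewrite addrC; apply: (tv_add hT) => //.
  - by move: k'; clear; cyc w x' y p.
  - by move: k; clear; cyc w x y p.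
have e2 : tv x' w y p = tv x w y p + tv x x' y p.
  have -> : tv x' w y p = tv y p w x'.
    by rewrite (tvCl t h x'); apply: tv_swap; move: k'; clear; cyc w x' y p.
  have -> : tv x w y p = tv y p w x.
    by rewrite (tvCl t h x); apply: tv_swap; move: k; clear; cyc w x y p.
  have -> : tv x x' y p = tv y p x x' by apply: tv_swap.
  apply: tv_add4; first by move: k; clear; cyc w x y p.
  by move: k2; clear; cyc x x' y p.
have e3 : tv y w x' x = tv p w x' x + tv x x' y p.
  have -> : tv y w x' x = tv x x' y w.
    by rewrite (tvCr hT y w); apply/esym/tv_swap; move: k' c; clear; cyc w x x' y p.
  have -> : tv p w x' x = tv x x' p w.
    by rewrite (tvCr hT p w); apply/esym/tv_swap; move: k' c; clear; cyc w x x' y p.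
  rewrite addrC; apply: tv_add4 => //.
  by move: k; clear; cyc w x y p.
by rewrite e1 e2 e3; lra.
Qed.

Definition line_coords w (phi : S1 R -> S1 R -> R) : Prop := forall x, x != w ->
  [/\ forall y y', cyc x y y' -> cyc x y' w -> phi x y' - phi x y = tv x w y y',
      forall y y', sep x w y y' -> h (ev x w) (ev y y') -> phi x y = phi x y' &
      forall y y', cyc w y' y -> cyc w y x -> phi x y' - phi x y = tv x w y y'].

Lemma coord_gap w phi x y p : line_coords w phi -> cyc4 w x y p ->
  phi x y - phi x p + (phi p x - phi p y) = tv p w y x - tv x w y p.
Proof.
move=> hphi k; have /and5P[wx wy wp xy /andP[xp yp]] := cyc4_neq k.
have xw : x != w by rewrite eq_sym.
have pw : p != w by rewrite eq_sym.
have [x1 _ _] := hphi _ xw; have [_ _ p3] := hphi _ pw.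
have e1 : phi x p - phi x y = tv x w y p.
  by apply: x1; move: k; clear; cyc w x y p.
have e2 : phi p x - phi p y = tv p w y x.
  by apply: p3; move: k; clear; cyc w x y p.
by rewrite e2 -e1; lra.
Qed.

(* By tv_perp the identity holds when the event (p, x) lies on the line of (y, w);
   its two sides have the same increments in x by additivity of time. *)
Lemma coord_triangle_sorted w phi : line_coords w phi -> forall x y p, cyc4 w x y p ->
  phi x y - phi x p + (phi p x - phi p y) + (phi y p - phi y x) = 0.
Proof.
move=> hphi x0 y p k0.
have /and5P[_ wy wp _ /andP[_ yp]] := cyc4_neq k0.
have yw : y != w by rewrite eq_sym.
have [y1 y2 y3] := hphi _ yw.
pose K x := phi x y - phi x p + (phi p x - phi p y).
have Kd x x' : cyc4 w x y p -> cyc w x x' -> cyc4 w x' y p ->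
    K x - K x' = phi y x - phi y x'.
  move=> k c k'; rewrite /K (coord_gap hphi k) (coord_gap hphi k').
  by rewrite time_increment// y3//; move: k'; clear; cyc w x' y p.
have [x' s' l'] := h_ex hT yw yp wp.
have k' : cyc4 w x' y p by move: s' k0; clear; rewrite /sep; cyc w x' y p x0.
have K0 : K x' = phi y x' - phi y p.
  have sx : sep w y x' p by rewrite sepCl sepCr.
  have lx : h (ev w y) (ev x' p) by rewrite (evC w) (evC x').
  rewrite /K (coord_gap hphi k') (y2 _ _ s' l') subrr.
  by rewrite (tvCl t h x') (tv_perp sx lx) (tvCl t h p) subrr.
suff : K x0 - K x' = phi y x0 - phi y x' by rewrite K0 /K; lra.
have [->|xx'] := eqVneq x0 x'; first by lra.
have [c|c] := boolP (cyc w x0 x'); first exact: Kd.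
have c' : cyc w x' x0.
  by move: c k0 k' xx'; clear; cyc w x0 x' y p.
by have := Kd _ _ k' c' k0; lra.
Qed.

End SemimetricOfTime.

(** * Cross-differences of a symmetric choice of line coordinates are times *)

Section CrossDifferences.
Variable R : realType.
Implicit Types x y a b c e q w : S1 R.

Lemma cyc_orders w x y q : x != w -> y != w -> q != w -> x != y -> y != q -> x != q ->
  [|| cyc4 w x y q, cyc4 w x q y, cyc4 w y x q, cyc4 w y q x, cyc4 w q x y |
      cyc4 w q y x].
Proof. cyc w x y q. Qed.

(** The cases place [w] between [e] and [a], [b] and [c], [a] and [b], [c] and [e], in this
    order. *)
Lemma cyc4_cut w a b c e : cyc4 a b c e -> a != w -> b != w -> c != w -> e != w ->
  [|| [&& cyc w a b, cyc w c e & cyc w b c], [&& cyc w c e, cyc w a b & cyc w e a],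
      cyc4 w b c e && cyc w e a | cyc4 w e a b && cyc w b c].
Proof. cyc w a b c e. Qed.

Variable H : set (set (event R)).
Variable t : event R -> event R -> option R.
Variable h : event R -> set (event R).
Hypothesis hT : timed_causal_axioms H t h.
Local Notation tv := (line_time t h).
Implicit Types G : S1 R -> S1 R -> R.

(** The normalisation [G x w = 0] is that of the logarithm of a semi-metric with remote point
    [w]. *)
Definition time_coords w G : Prop :=
  [/\ forall x y, G x y = G y x,
      forall x, G x w = 0,
      forall x y y', cyc x y y' -> cyc x y' w -> G x y' - G x y = tv x w y y' &
      forall x y y', cyc w y' y -> cyc w y x -> G x y' - G x y = tv x w y y'].

Definition time_cross G a b c e : Prop := G a c + G b e - G b c - G a e = tv a b c e.

(** Here [w] lies between [e] and [a]; the coordinates measure the arcs from [w] to [a] and from [w]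
    to [b] against the arc from [c] to [e], and these differ by the arc from [a] to [b]. *)
Lemma time_cross_right w G a b c e : time_coords w G -> cyc4 a b c e ->
  cyc w a b -> cyc w c e -> cyc w b c -> time_cross G a b c e.
Proof.
move=> [_ _ GR _] k1 c1 c2 c3; rewrite /time_cross.
have c4 : cyc w a c by move: c1 c3; clear; cyc w a b c.
have e1 : G b e - G b c = tv b w c e by apply: GR; move: c2 c3; clear; cyc w b c e.
have e2 : G a e - G a c = tv a w c e by apply: GR; move: c2 c4; clear; cyc w a c e.
have -> : tv a b c e = tv c e a b by apply: (tv_swap hT).
have s1 : tv b w c e = tv c e w b.
  by rewrite (tvCl t h b); apply: (tv_swap hT); move: c2 c3; clear; cyc w b c e.
have s2 : tv a w c e = tv c e w a.
  by rewrite (tvCl t h a); apply: (tv_swap hT); move: c2 c4; clear; cyc w a c e.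
have s3 : tv c e w b = tv c e w a + tv c e a b.
  apply: (tv_add4 hT); first by move: c2 c4; clear; cyc w a c e.
  by move: k1; clear; cyc c e a b.
lra.
Qed.

(** Here [w] lies between [a] and [b] and splits this arc. *)
Lemma time_cross_left w G a b c e : time_coords w G ->
  cyc4 w b c e -> cyc w e a -> time_cross G a b c e.
Proof.
move=> [_ _ GR GL] k1 c1; rewrite /time_cross.
have k2 : cyc4 w c e a by move: k1 c1; clear; cyc w b c e a.
have e1 : G b e - G b c = tv b w c e by apply: GR; move: k1; clear; cyc w b c e.
have e2 : G a c - G a e = tv a w e c by apply: GL; move: k2; clear; cyc w c e a.
have -> : tv a b c e = tv c e a b.
  by apply: (tv_swap hT); move: k1 c1; clear; cyc w b c e a.
have s1 : tv b w c e = tv c e w b by rewrite (tvCl t h b); exact: (tv_swap hT).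
have s2 : tv a w e c = tv c e a w.
  by rewrite (tvCr hT a w); apply: (tv_swap hT); move: k2; clear; cyc w c e a.
have s3 : tv c e a b = tv c e a w + tv c e w b.
  apply: (tv_add4 hT); first by move: k2; clear; cyc w c e a.
  by move: k1; clear; cyc w b c e.
lra.
Qed.

Lemma time_cross_last w G a b c : time_coords w G -> cyc4 a b c w -> time_cross G a b c w.
Proof.
move=> [Gsym G0 _ GL] k1; rewrite /time_cross !G0.
have e1 : G c a - G c b = tv c w b a by apply: GL; move: k1; clear; cyc w a b c.
have -> : tv a b c w = tv c w a b by apply: (tv_swap hT).
by rewrite (tvCr hT c w a b) -e1 (Gsym a) (Gsym b); lra.
Qed.

Lemma time_cross_first w G b c e : time_coords w G -> cyc4 w b c e -> time_cross G w b c e.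
Proof.
move=> [Gsym G0 GR _] k1; rewrite /time_cross !(Gsym w) !G0.
have e1 : G b e - G b c = tv b w c e by apply: GR; move: k1; clear; cyc w b c e.
by rewrite (tvCl t h w) -e1; lra.
Qed.

Lemma time_cross_swap w G a b c e : time_coords w G -> cyc4 a b c e ->
  time_cross G c e a b -> time_cross G a b c e.
Proof.
move=> [Gsym _ _ _] k1; rewrite /time_cross (tv_swap hT k1) => <-.
by rewrite (Gsym c a) (Gsym e b) (Gsym e a) (Gsym c b); lra.
Qed.

Lemma time_cross_all w G a b c e : time_coords w G -> cyc4 a b c e -> time_cross G a b c e.
Proof.
move=> hG k1; have k2 : cyc4 c e a b by rewrite -2!cyc4_rot.
have [ew|ew] := eqVneq e w; first by rewrite ew in k1 *; exact: time_cross_last hG _.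
have [aw|aw] := eqVneq a w; first by rewrite aw in k1 *; exact: time_cross_first hG _.
have [bw|bw] := eqVneq b w.
  by apply: (time_cross_swap hG k1); rewrite bw in k2 *; exact: time_cross_last hG _.
have [cw|cw] := eqVneq c w.
  by apply: (time_cross_swap hG k1); rewrite cw in k2 *; exact: time_cross_first hG _.
case/or4P: (cyc4_cut k1 aw bw cw ew).
- by case/and3P; exact: time_cross_right hG k1.
- case/and3P => c1 c2 c3; apply: (time_cross_swap hG k1).
  exact: time_cross_right hG k2 c1 c2 c3.
- by case/andP; exact: time_cross_left hG.
- case/andP => c1 c2; apply: (time_cross_swap hG k1).
  exact: time_cross_left hG c1 c2.
Qed.

End CrossDifferences.

(** * The logarithmic distance determined by time *)

Section LogDistanceOfTime.
Variable R : realType.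
Variable H : set (set (event R)).
Variable t : event R -> event R -> option R.
Variable h : event R -> set (event R).
Hypothesis hT : timed_causal_axioms H t h.
Implicit Types x y z u v p q w a b c e : S1 R.
Local Notation tv := (line_time t h).

(* Time is the logarithm of a cross-ratio of exp G. *)
Definition log_of_time (G : S1 R -> S1 R -> R) : Prop :=
  (forall x y, G x y = G y x) /\
  forall a b c e, cyc4 a b c e -> G a c + G b e - G b c - G a e = tv a b c e.

Lemma log_of_time_ex : exists G, log_of_time G.
Proof.
have [w _] : exists w : S1 R, True by exists (S1_base R).
have [phi hphi] := choice (fun x => line_coord hT x w).
have [p pw _] := exists_neq2 w w.
have tri x y q : x != w -> y != w -> q != w -> x != y -> y != q -> x != q ->
    phi x y - phi x q + (phi q x - phi q y) + (phi y q - phi y x) = 0.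
  move=> xw yw qw xy yq xq; have S := coord_triangle_sorted hT hphi.
  (* The sum is alternating in the three points, so every order reduces to the sorted one. *)
  have := cyc_orders xw yw qw xy yq xq.
  by do 5?[case/orP]; move/S; lra.
(* The additive constant of [phi x], chosen so that [G x p = G p x]; [tri] applied to [x], [y], [p]
   then gives symmetry in general. *)
pose k x := if x == p then 0 else phi p x - phi x p.
pose G x y := if (x == w) || (y == w) then 0 else phi x y + k x.
have Gsym x y : G x y = G y x.
  rewrite /G orbC; case: ifPn => // /norP[yw xw].
  have [->//|xy] := eqVneq x y; rewrite /k.
  have [xp|xp] := eqVneq x p; have [yp|yp] := eqVneq y p.
  - by rewrite xp yp.
  - by rewrite xp; lra.
  - by rewrite yp; lra.
  - by have := tri _ _ _ xw yw pw xy yp xp; lra.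
have G0 x : G x w = 0 by rewrite /G eqxx orbT.
have GR x y y' : cyc x y y' -> cyc x y' w -> G x y' - G x y = tv x w y y'.
  move=> c1 c2; have xw : x != w by move: c2; clear; cyc w x y'.
  have yw : y != w by move: c1 c2; clear; cyc w x y y'.
  have yw' : y' != w by move: c2; clear; cyc w x y'.
  have [/(_ _ _ c1 c2) E _ _] := hphi _ xw.
  by rewrite /G (negbTE xw) (negbTE yw) (negbTE yw') /= -E; lra.
have GL x y y' : cyc w y' y -> cyc w y x -> G x y' - G x y = tv x w y y'.
  move=> c1 c2; have xw : x != w by move: c2; clear; cyc w x y.
  have yw : y != w by move: c2; clear; cyc w x y.
  have yw' : y' != w by move: c1; clear; cyc w y y'.
  have [_ _ /(_ _ _ c1 c2) E] := hphi _ xw.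
  by rewrite /G (negbTE xw) (negbTE yw) (negbTE yw') /= -E; lra.
by exists G; split => // a b c e; apply: (time_cross_all hT (w := w)); split.
Qed.

(** Monotonicity is the positivity of time. For surjectivity, (t4) is applied at some point [y0] of
    the arc, towards [w] or towards [p]. *)
Lemma log_of_time_moebius G : log_of_time G -> log_moebius G.
Proof.
move=> [Gs Q]; split => //.
  move=> x y z u k; have k' : cyc4 y z u x by move: k; clear; cyc x y z u.
  have /and5P[_ _ _ yz _] := cyc4_neq k.
  have : 0 < tv y z u x.
    rewrite (tvCl t h y); apply: (tv_gt0 hT); move: k; clear; cyc x y z u.
  by rewrite -(Q _ _ _ _ k') (Gs z x) (Gs y x); lra.
move=> p w s pw; have [y0 h0] := arc_ex pw.
have step y y' : cyc p y y' -> cyc p y' w ->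
    G p y' - G w y' - (G p y - G w y) = tv p w y y'.
  move=> c1 c2; have k : cyc4 w p y y' by move: c1 c2; clear; cyc p w y y'.
  by rewrite (tvCl t h p w) -(Q _ _ _ _ k); lra.
have [hs|hs|hs] := ltgtP (G p y0 - G w y0) s.
- have [|y [c1 c2 E]] := tv_reach_right hT h0 (s := s - (G p y0 - G w y0)); first lra.
  by exists y => //; have := step _ _ c1 c2; rewrite E; lra.
- have [|y c1 E] := tv_reach_left hT h0 (s := (G p y0 - G w y0) - s); first lra.
  exists y; first by move: c1 h0; clear; cyc p y y0 w.
  by have := step _ _ c1 h0; rewrite (tvCr hT) E; lra.
- by exists y0.
Qed.

End LogDistanceOfTime.

(** * Both constructions are independent of the choices made *)

Section MhatThat.
Variable R : realType.
Implicit Types d : semimetric R.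
Implicit Types M : moebius R.
Implicit Types T : timed_causal_space R.
Implicit Types x y z u v p q w a b c : S1 R.

Section SemimetricOfLog.
Variable G : S1 R -> S1 R -> R.
Hypothesis Gs : forall x y, G x y = G y x.

Definition exp_dist x y : \bar R := if x == y then 0%E else (expR (G x y))%:E.

Lemma exp_dist_semimetric : is_semimetric exp_dist.
Proof.
have fin x y : exp_dist x y <> +oo%E by rewrite /exp_dist; case: ifP.
have nrem w : ~ inf_remote exp_dist w.
  by have [x xw _] := exists_neq2 w w => /(_ x xw); exact: fin.
split.
- by move=> x y; rewrite /exp_dist eq_sym Gs.
- by move=> x; rewrite /exp_dist eqxx.
- by move=> x y xy; rewrite /exp_dist (negbTE xy) lte_fin expR_gt0.
- by move=> x y /fin.
- by move=> w w' /nrem.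
Qed.

Definition semimetric_of_log : semimetric R := Semimetric exp_dist_semimetric.

Lemma ld_of_log x y : x != y -> ld semimetric_of_log x y = G x y.
Proof. by move=> xy; rewrite /ld /fdist /= /exp_dist (negbTE xy) expRK. Qed.

End SemimetricOfLog.

Lemma time_semimetric_ex H t h : timed_causal_axioms H t h ->
  exists d, log_of_time t h (ld d).
Proof.
move=> hT; have [G [Gs Q]] := log_of_time_ex hT.
exists (semimetric_of_log Gs); split; first exact: ld_sym.
move=> a b c e k; have /and5P[ab ac ae bc /andP[be ce]] := cyc4_neq k.
by rewrite -(Q _ _ _ _ k) !ld_of_log.
Qed.

Lemma log_of_time_equiv t h d d' : moebius_equiv d d' ->
  log_of_time t h (ld d) -> log_of_time t h (ld d').
Proof.
move=> /moebius_equivP E [_ Q]; split; first exact: ld_sym.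
move=> a b c e k; rewrite -(Q _ _ _ _ k).
have U : uniq [:: a; b; c; e] by rewrite uniq4; exact: cyc4_neq.
by have := E _ _ _ _ U; rewrite /lcr; lra.
Qed.

(** The differences for one cyclic arrangement of the points and for its rotation by one place yield
    by linear combination those for every ordering. *)
Lemma cross_difference_eq (f f' : S1 R -> S1 R -> R) :
  (forall x y, f x y = f y x) -> (forall x y, f' x y = f' y x) ->
  (forall a b c e, cyc4 a b c e ->
    f a c + f b e - f b c - f a e = f' a c + f' b e - f' b c - f' a e) ->
  forall x y z u, uniq [:: x; y; z; u] ->
    f x z + f y u - (f x u + f y z) = f' x z + f' y u - (f' x u + f' y z).
Proof.
move=> fs fs' E x y z u; rewrite uniq4 => U.
have P : [|| cyc4 x y z u, cyc4 x y u z, cyc4 x z y u, cyc4 x z u y, cyc4 x u y z | cyc4 x u z y].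
  by move: U; clear; cyc x y z u.
have R1 a b c e : cyc4 a b c e -> cyc4 b c e a by rewrite cyc4_rot.
move: (fs x y) (fs x z) (fs x u) (fs y z) (fs y u) (fs z u).
move: (fs' x y) (fs' x z) (fs' x u) (fs' y z) (fs' y u) (fs' z u).
by move: P; do 5?[case/orP]; move=> k; have := E _ _ _ _ k; have := E _ _ _ _ (R1 _ _ _ _ k); lra.
Qed.

Lemma log_of_time_uniq t h d d' :
  log_of_time t h (ld d) -> log_of_time t h (ld d') -> moebius_equiv d d'.
Proof.
move=> [_ Q] [_ Q']; apply/moebius_equivP => x y z u.
apply: cross_difference_eq => [||a b c e k]; try exact: ld_sym.
by rewrite (Q _ _ _ _ k) (Q' _ _ _ _ k).
Qed.

Lemma line_ofP T : timed_causal_axioms (lines T) (time T) (line_of T).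
Proof. exact: (svalP (cid (tcsP T))). Qed.

(** For separating pairs the two equations of [is_Mhat] are the identity of [log_of_time] for a
    quadruple in cyclic order and for a rotation of it. *)
Lemma is_MhatP T M : is_Mhat T M <->
  forall d, M d -> log_of_time (time T) (line_of T) (ld d).
Proof.
have hT := line_ofP T; split => [hM d Md|hM x y z u c c' a b d Md].
  split; first exact: ld_sym.
  move=> a b c e k.
  have /and5P[ab ac ae bc /andP[be ce]] := cyc4_neq k.
  have S : separate (ev a c) (ev b e).
    by apply/(separate_ev ac be); rewrite /sep k.
  have U' : uniq [:: a; b; e; c] by rewrite uniq4 ab ae ac be bc eq_sym ce.
  have [E _] := hM _ _ _ _ _ _ _ _ _ Md U' (pair_of_ev ac) (pair_of_ev be) S
    (pair_of_ev ab) (pair_of_ev bc).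
  move: E; rewrite (tv_Some hT)// => -[]; rewrite (tvCr hT) ln_quot// => ->.
  lra.
rewrite uniq4 => /and5P[xy xz xu yz /andP[yu zu]].
move=> /pair_ofE[_ ->] /pair_ofE[_ ->] /(separate_ev xu yz) S /pair_ofE[_ ->] /pair_ofE[_ ->].
have [Gs Q] := hM _ Md.
have yx : y != x by rewrite eq_sym.
have [ux uz] : u != x /\ u != z by rewrite !(eq_sym u).
rewrite !(tv_Some hT)// 1?(eq_sym u)// !ln_quot//.
move: (ld_sym d x y) (ld_sym d x z) (ld_sym d x u) (ld_sym d y z) (ld_sym d y u) (ld_sym d z u).
case/orP: S => k.
  have k' : cyc4 y u z x by move: k; clear; cyc x y z u.
  rewrite (tvCr hT x) (tvCr hT y u x) -(Q _ _ _ _ k) -(Q _ _ _ _ k').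
  by move=> *; split; congr Some; lra.
have k1 : cyc4 y x z u by move: k; clear; cyc x y z u.
have k2 : cyc4 u y x z by move: k; clear; cyc x y z u.
rewrite (tvCl _ _ x y) (tvCl _ _ y u) -(Q _ _ _ _ k1) -(Q _ _ _ _ k2).
by move=> *; split; congr Some; lra.
Qed.

Lemma pts_off_line H t (h : event R -> set (event R)) e : timed_causal_axioms H t h ->
  pts e = [set x | ~ exists g, h e g /\ pts g x].
Proof.
move=> hT; apply/seteqP; split=> x /=.
  move=> ex [a [ka ax]]; have [dis _] := tc_h2 hT ka.
  by have : (set0 : set (S1 R)) x by rewrite -dis.
move=> nx; apply: contrapT => ex; apply: nx.
by have [a [[ka ax] _]] := tc_h4 hT ex; exists a.
Qed.

Lemma timed_causal_lines_uniq H t h h' :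
  @timed_causal_axioms R H t h -> timed_causal_axioms H t h' -> h = h'.
Proof.
move=> hT hT'; apply/funext => e.
have : range h' (h e) by rewrite -(tc_h1 hT') (tc_h1 hT); exists e.
move=> [e' _ E]; rewrite -E; congr h'; apply: event_ext.
by rewrite (pts_off_line e hT) (pts_off_line e' hT') E.
Qed.

Lemma tcs_eq T T' : lines T = lines T' ->
  (forall e e' s, time T e e' = Some s <-> time T' e e' = Some s) -> T = T'.
Proof.
case: T T' => l t P [l' t' P'] /= ll E; have tt : t = t'.
  apply/funext => a; apply/funext => a'.
  case F : (t a a') => [s|]; first by apply/esym/E.
  by case F' : (t' a a') => [s|] //; move/E: F'; rewrite F.
by subst l' t'; congr TimedCausalSpace; exact: Prop_irrelevance.
Qed.

Lemma mm_eq (M M' : monotone_moebius R) : mm_moebius M = mm_moebius M' -> M = M'.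
Proof.
case: M M' => M P [M' P'] /= MM'; subst M'.
by congr MonotoneMoebius; exact: Prop_irrelevance.
Qed.

Lemma is_That_uniq M T T' : is_That M T -> is_That M T' -> T = T'.
Proof.
have [d Md] := moebius_ex M.
move=> /(_ _ Md)[_ l E] /(_ _ Md)[_ l' E']; apply: tcs_eq; first by rewrite l l'.
by move=> a a' s; rewrite E E'.
Qed.

Section Invariance.
Variables d d' : semimetric R.
Hypothesis hd : log_moebius (ld d).
Hypothesis dd' : moebius_equiv d d'.
Let hd' := log_moebius_equiv dd' hd.

Lemma lr_equiv x y z z' : x != y -> x != z -> y != z -> x != z' -> y != z' ->
  lr (ld d) x y z' - lr (ld d) x y z = lr (ld d') x y z' - lr (ld d') x y z.
Proof.
move=> xy xz yz xz' yz'; have [->|zz'] := eqVneq z z'; first by rewrite !subrr.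
have U : uniq [:: x; y; z; z'] by rewrite uniq4 xy xz xz' yz yz' zz'.
have /moebius_equivP/(_ _ _ _ _ U) := dd'.
by rewrite /lcr /lr; lra.
Qed.

Lemma sm_line_equiv : sm_line d = sm_line d'.
Proof.
apply/funext => e; apply/seteqP.
have [x [y [xy ->]]] := event_pair e.
have E z u : sep x y z u -> harm (ld d) x y z u <-> harm (ld d') x y z u.
  move=> /sep_uniq/and5P[_ xz xu yz /andP[yu _]].
  by have := lr_equiv xy xz yz xu yu; rewrite /harm; split; lra.
split => a; have [z [u [zu ->]]] := event_pair a.
  move=> /(sm_line_ev hd xy zu)[s k]; apply/(sm_line_ev hd' xy zu).
  by split => //; apply/(E _ _ s).
move=> /(sm_line_ev hd' xy zu)[s k]; apply/(sm_line_ev hd xy zu).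
by split => //; apply/(E _ _ s).
Qed.

Lemma sm_time_equiv (a a' : event R) s : sm_time d a a' s <-> sm_time d' a a' s.
Proof.
have [l|l] := pselect (on_light_line a a').
  by split=> -[[_ ->]|[[_ []]]] //; left.
have [c|c] := pselect (causal a a'); last by split=> /sm_time_causal.
have [x [y [z [u [z' [u' [[xy zu zu'] aE aE' [k k' _ _]]]]]]]] :=
  strong_causal_line hd (conj c l).
rewrite aE aE' (sm_time_line hd s xy zu zu' k k').
have [s1 _] := iffLR (sm_line_ev hd xy zu) k.
have [s2 _] := iffLR (sm_line_ev hd xy zu') k'.
rewrite sm_line_equiv in k k'; rewrite (sm_time_line hd' s xy zu zu' k k').
move/sep_uniq/and5P: s1 => [_ xz _ yz _]; move/sep_uniq/and5P: s2 => [_ xz' _ yz' _].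
by rewrite /line_dist lr_equiv.
Qed.

End Invariance.

Lemma is_ThatP T M d : M d -> log_moebius (ld d) -> line_of T = sm_line d ->
  (forall e e' s, time T e e' = Some s <-> sm_time d e e' s) -> is_That M T.
Proof.
move=> Md hd lE tE d' Md'; have e : moebius_equiv d d'.
  by have ME := moebius_ofP Md; rewrite ME in Md'.
rewrite -(sm_line_equiv hd e); split => //; first by rewrite (tc_h1 (line_ofP T)) lE.
by move=> a a' s; rewrite tE; exact: sm_time_equiv.
Qed.

End MhatThat.

(** * Lines and times recovered from the semi-metric of a timed causal space *)

Section SpaceOfTime.
Variable R : realType.
Variable H : set (set (event R)).
Variable t : event R -> event R -> option R.
Variable h : event R -> set (event R).
Hypothesis hT : timed_causal_axioms H t h.
Variable d : semimetric R.
Hypothesis L : log_of_time t h (ld d).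
Implicit Types x y z u v p q w : S1 R.
Implicit Types e a : event R.
Local Notation tv := (line_time t h).
Let hd := log_of_time_moebius hT L.

(** Axiom (t6) equates times on the lines of [(x, z)] and [(x, u)]; written as cross-differences of
    [ld d], this is the harmonic equation. *)
Lemma h_harm x y z u : sep x y z u -> h (ev x y) (ev z u) -> harm (ld d) x y z u.
Proof.
have [Gs Q] := L; move=> s k; have := tv_perp hT s k; rewrite /harm /lr.
move: (Gs x y) (Gs x z) (Gs x u) (Gs y z) (Gs y u) (Gs z u).
case/orP: s => c.
  have c' : cyc4 u x z y by move: c; clear; cyc x y z u.
  by rewrite (tvCl t h x u) (tvCr hT u x) -(Q _ _ _ _ c) -(Q _ _ _ _ c'); lra.
have c' : cyc4 z x u y by move: c; clear; cyc x y z u.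
by rewrite (tvCl t h x z) (tvCr hT z x) -(Q _ _ _ _ c) -(Q _ _ _ _ c'); lra.
Qed.

(** One inclusion is [h_harm]. For the other, [h] has an event through [z], and its second end is
    the unique harmonic partner of [z]. *)
Lemma line_of_time : h = sm_line d.
Proof.
apply/funext => e; have [x [y [xy ->]]] := event_pair e.
apply/seteqP; split => a; have [z [u [zu ->]]] := event_pair a => k.
  have s := h_sep hT xy zu k; apply/(sm_line_ev hd xy zu).
  by split => //; exact: h_harm.
have [s g] := iffLR (sm_line_ev hd xy zu) k.
have /and5P[_ xz _ yz _] := sep_uniq s.
have [u' s' k'] := h_ex hT xy xz yz.
by rewrite (harm_uniq hd s s' g (h_harm s' k')).
Qed.

Lemma line_time_dist x y z z' : cyc x z y -> cyc x z' y ->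
  tv x y z z' = line_dist d x y z z'.
Proof.
have [Gs Q] := L.
have gen v v' : cyc x v y -> cyc x v' y -> cyc x v v' -> tv x y v v' = line_dist d x y v v'.
  move=> c c' k; have k4 : cyc4 y x v v' by move: c c' k; clear; cyc x y v v'.
  rewrite (tvCl t h x) -(Q _ _ _ _ k4) /line_dist /lr.
  have := lm_mono hd k4; have k5 : cyc4 x v v' y by move: k4; clear; cyc x y v v'.
  have := lm_mono hd k5; rewrite (Gs y v) (Gs y v') => i1 i2.
  by rewrite gtr0_norm; lra.
move=> c c'; have [->|zz'] := eqVneq z z'.
  have /and3P[xz zy xy] := cyc_neq c'.
  by rewrite (tv_self hT)// 1?eq_sym// /line_dist subrr normr0.
case: (boolP (cyc x z z')) => k; first exact: gen.
rewrite (tvCr hT) /line_dist distrC; apply: gen => //.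
by move: c c' k zz'; clear; cyc x y z z'.
Qed.

Lemma time_sm_time a a' s : t a a' = Some s <-> sm_time d a a' s.
Proof.
have causal_t : forall s, t a a' = Some s -> sm_time d a a' s.
  move=> r E; have c : causal a a' by apply/(tc_t1_def hT); exists r.
  have [l|l] := pselect (on_light_line a a').
    by left; split => //; move/(tc_t2 hT): l; rewrite E => -[].
  have [x [y [z [u [z' [u' [[xy zu zu'] aE aE' [k k' c1 c2]]]]]]]] :=
    strong_causal_line hd (conj c l).
  rewrite aE aE' in E *; apply/(sm_time_line hd _ xy zu zu' k k').
  have s1 : sep x y z u by rewrite /sep c1.
  have s2 : sep x y z' u' by rewrite /sep c2.
  rewrite -line_of_time in k k'; have <- := iffLR (tv_eq hT r s1 k s2 k') E.
  by apply: line_time_dist; [case/andP: c1|case/andP: c2].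
split=> [|st]; first exact: causal_t.
have [r E] := iffRL (tc_t1_def hT a a') (sm_time_causal st).
by rewrite E (sm_time_uniq hd st (causal_t _ E)).
Qed.

End SpaceOfTime.

(** * The two constructions exist and invert each other *)

Section MutuallyInverse.
Variable R : realType.
Implicit Types M : moebius R.
Implicit Types T : timed_causal_space R.

Lemma is_Mhat_That T M : is_Mhat T M -> is_That M T.
Proof.
move=> /is_MhatP hM; have [d Md] := moebius_ex M.
have hT := line_ofP T; have L := hM _ Md.
apply: (is_ThatP Md (log_of_time_moebius hT L) (line_of_time hT L)).
exact: (time_sm_time hT L).
Qed.

Lemma is_That_Mhat T M : is_monotone M -> is_That M T -> is_Mhat T M.
Proof.
move=> mM hM; apply/is_MhatP => d Md; have hd := monotone_log_moebius mM Md.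
have [lE _ tE] := hM _ Md; split; first exact: ld_sym.
move=> a b c e k; have /and5P[ab ac ae bc /andP[be ce]] := cyc4_neq k.
have -> : line_time (time T) (line_of T) a b c e = line_dist d a b c e.
  rewrite /line_time lE.
  by move: (sm_timeo_at hd ab ac bc ae be) => /(sm_timeoE hd)/tE ->.
have k' : cyc4 b c e a by move: k; clear; cyc a b c e.
have := lm_mono hd k'; rewrite /line_dist /lr (ld_sym d c a) (ld_sym d e a) => i.
by rewrite ltr0_norm; lra.
Qed.

Lemma is_Mhat_uniq T M M' : is_Mhat T M -> is_Mhat T M' -> M = M'.
Proof.
move=> /is_MhatP hM /is_MhatP hM'.
have [d Md] := moebius_ex M; have [d' Md'] := moebius_ex M'.
rewrite (moebius_ofP Md'); apply: moebius_ofP.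
rewrite (moebius_ofP Md) /=; exact: log_of_time_uniq (hM _ Md) (hM' _ Md').
Qed.

Lemma That_ex (M : monotone_moebius R) : exists T, is_That M T.
Proof.
have [d Md] := moebius_ex M.
have hd := monotone_log_moebius (mm_monotone M) Md.
have ax := sm_timed_causal_axioms hd.
pose T := TimedCausalSpace (ex_intro _ _ ax).
exists T; apply: (is_ThatP Md hd); last exact: sm_timeoE.
(* [line_of T] is extracted from an existence statement, so only the uniqueness of [h] identifies it
   with [sm_line d]. *)
exact: timed_causal_lines_uniq (line_ofP T) ax.
Qed.

Lemma Mhat_ex T : exists M : monotone_moebius R, is_Mhat T M.
Proof.
have hT := line_ofP T; have [d L] := time_semimetric_ex hT.
have Md : moebius_of d d by exact: moebius_equiv_refl.
have mM := log_moebius_monotone Md (log_of_time_moebius hT L).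
exists (MonotoneMoebius mM); apply/is_MhatP => d' Md'.
exact: log_of_time_equiv Md' L.
Qed.

End MutuallyInverse.

(** * Bijections of events induced by bijections of the circle *)

Section EventMap.
Variable R : realType.
Implicit Types x y z u v p q w : S1 R.
Implicit Types e a : event R.
Implicit Types f g : S1 R -> S1 R.

Lemma event_map_ev g x y : injective g -> x != y ->
  event_map g (ev x y) = ev (g x) (g y).
Proof.
move=> gi xy; have gxy : g x != g y by rewrite (inj_eq gi).
have E : pts (ev (g x) (g y)) = g @` pts (ev x y).
  by rewrite !pts_ev// image_setU !image_set1.
rewrite /event_map; case: xgetP => [e _ /= eE|/(_ (ev (g x) (g y)))//].
by apply: event_ext; rewrite eE E.
Qed.

Lemma event_map_id : event_map (@id (S1 R)) = id.
Proof.
apply/funext => e; have [x [y [xy ->]]] := event_pair e.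
by rewrite event_map_ev.
Qed.

Lemma event_map_comp f g : injective f -> injective g ->
  event_map (f \o g) = event_map f \o event_map g.
Proof.
move=> fi gi; apply/funext => e; have [x [y [xy ->]]] := event_pair e.
rewrite (event_map_ev (inj_comp fi gi) xy) /= (event_map_ev gi xy) event_map_ev//.
by rewrite (inj_eq gi).
Qed.

Lemma event_map_bij g : bijective g -> bijective (event_map g).
Proof.
move=> [g' gK g'K]; exists (event_map g') => e.
  rewrite -[LHS]/((event_map g' \o event_map g) e) -event_map_comp.
  - by rewrite (_ : g' \o g = id) ?event_map_id//; apply/funext => x /=; rewrite gK.
  - exact: can_inj g'K.
  - exact: can_inj gK.
rewrite -[LHS]/((event_map g \o event_map g') e) -event_map_comp.
- by rewrite (_ : g \o g' = id) ?event_map_id//; apply/funext => x /=; rewrite g'K.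
- exact: can_inj gK.
- exact: can_inj g'K.
Qed.

(** If [f x] differed from [g x], it would equal [g y] for each [y] other than [x], which fails for
    two such points. *)
Lemma event_map_inj f g : injective f -> injective g ->
  event_map f = event_map g -> f = g.
Proof.
move=> fi gi E; apply/funext => x; have [y yx _] := exists_neq2 x x.
have xy : x != y by rewrite eq_sym.
have [z zx zy] := exists_neq2 x y; have xz : x != z by rewrite eq_sym.
have Fy : ev (f x) (f y) = ev (g x) (g y) by rewrite -!event_map_ev// E.
have Fz : ev (f x) (f z) = ev (g x) (g z) by rewrite -!event_map_ev// E.
have i (h : S1 R -> S1 R) u v : injective h -> u != v -> h u != h v.
  by move=> hi; rewrite (inj_eq hi).
have [[]//|[e1 _]] := ev_inj (i f _ _ fi xy) (i g _ _ gi xy) Fy.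
have [[]//|[e2 _]] := ev_inj (i f _ _ fi xz) (i g _ _ gi xz) Fz.
by move: zy; rewrite e1 in e2; rewrite (gi _ _ e2) eqxx.
Qed.

Lemma exists_notin (s : seq (S1 R)) : exists v, v \notin s.
Proof.
have w := S1_base R; suff [m hm] : exists m, forall r, m < r -> unstereo w r \notin s.
  by exists (unstereo w (m + 1)); apply: hm; rewrite ltrDl.
elim: s => [|x s [m hm]]; first by exists 0.
case: (unstereoP w x) => [|a].
  by exists m => r /hm; rewrite inE base_unstereo.
exists (Num.max m a) => r; rewrite gt_max => /andP[/hm mr ar].
by rewrite inE eq_unstereo gt_eqF.
Qed.

(* Pairwise intersecting two-point sets have a common point or form a triangle. *)
Lemma common_point x (A : S1 R -> event R) :
  (forall y y', y != x -> y' != x -> A y = A y' -> y = y') ->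
  (forall y y', y != x -> y' != x -> on_light_line (A y) (A y')) ->
  exists p, forall y, y != x -> pts (A y) p.
Proof.
move=> Ai Al; have [y1 y1x _] := exists_neq2 x x.
have [y2 y2x y21] := exists_neq2 x y1.
have /on_light_lineE[p [p1 p2]] := Al _ _ y1x y2x.
have [q pq A1] := event_pt p1; have [r pr A2] := event_pt p2.
have qr : q != r.
  apply/eqP => e; move: y21; rewrite (Ai _ _ y2x y1x) ?eqxx//.
  by rewrite A1 A2 e.
have meet y s : y != x -> forall y', y' != x -> A y' = ev p s -> p != s ->
    ~ pts (A y) p -> pts (A y) s.
  move=> yx y' y'x E ps np; have /on_light_lineE[c [cy]] := Al _ _ yx y'x.
  by rewrite E pts_ev// => -[] e; rewrite e in cy.
exists p => y yx; apply: contrapT => np.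
have Ay : A y = ev q r.
  by apply: ev_of_pts => //; [exact: (meet y q yx y1)|exact: (meet y r yx y2)].
(* [A y1], [A y2], [A y] form the triangle [p], [q], [r]. A two-point set that meets all three sides
   is itself a side, so a fourth event contradicts injectivity. *)
have [z] := exists_notin [:: x; y1; y2; y].
rewrite !inE !negb_or => /and4P[zx z1 z2 zy].
have [zp|nzp] := pselect (pts (A z) p).
  have /on_light_lineE[c [cz]] := Al _ _ zx yx.
  rewrite Ay pts_ev// => -[] e; rewrite e in cz.
    by move: z1; rewrite (Ai _ _ zx y1x) ?eqxx// A1; exact: ev_of_pts.
  by move: z2; rewrite (Ai _ _ zx y2x) ?eqxx// A2; exact: ev_of_pts.
move: zy; rewrite (Ai _ _ zx yx) ?eqxx// Ay.
by apply: ev_of_pts => //; [exact: (meet z q zx y1)|exact: (meet z r zx y2)].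
Qed.

(* Bijections of events which preserve intersections map pencils of events to
   pencils. *)
Lemma event_map_surj (F : event R -> event R) : bijective F ->
  (forall e e', on_light_line e e' -> on_light_line (F e) (F e')) ->
  exists2 g, bijective g & F = event_map g.
Proof.
move=> Fb Fl; have Fi := bij_inj Fb.
have ex x : exists p, forall y, y != x -> pts (F (ev x y)) p.
  apply: common_point => y y' yx y'x.
    have xy : x != y by rewrite eq_sym.
    have xy' : x != y' by rewrite eq_sym.
    by move=> /Fi/(ev_inj xy xy')[[]//|[e1 e2]]; rewrite e2 eqxx in yx.
  by apply/Fl/on_light_lineE; exists x; rewrite !pts_ev 1?eq_sym//; split; left.
have [g hg] := choice ex.
have gx x y : x != y -> pts (F (ev x y)) (g x) by rewrite eq_sym; exact: hg.
have gy x y : x != y -> pts (F (ev x y)) (g y) by rewrite evC; exact: hg.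
have surj e : exists e', F e' = e by case: Fb => F' _ F'K; exists (F' e).
have gi : injective g.
  move=> x y gxy; apply: contrapT => /eqP nxy.
  (* If [g x = g y] with [x] and [y] distinct, then [g] is constant, every image under [F] contains
     [g x], and an event that avoids this point contradicts surjectivity. *)
  have all z : g z = g x.
    have [->//|zx] := eqVneq z x; have [->//|zy] := eqVneq z y.
    apply: contrapT => /eqP nz; have xz : x != z by rewrite eq_sym.
    have yz : y != z by rewrite eq_sym.
    have e1 : F (ev x z) = ev (g z) (g x) by apply: ev_of_pts => //; [exact: gy|exact: gx].
    have e2 : F (ev y z) = ev (g z) (g x).
      by apply: ev_of_pts => //; [exact: gy|rewrite gxy; exact: gx].
    have /(ev_inj xz yz)[[e _]|[e _]] : ev x z = ev y z by apply: Fi; rewrite e1 e2.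
      by rewrite e eqxx in nxy.
    by rewrite e eqxx in xz.
  have [a ax _] := exists_neq2 (g x) (g x); have [b bx ba] := exists_neq2 (g x) a.
  have ab : a != b by rewrite eq_sym.
  have [e E] := surj (ev a b); have [z [u [zu eE]]] := event_pair e.
  have := gx _ _ zu; rewrite -eE E all pts_ev// => -[] e'.
    by rewrite e' eqxx in ax.
  by rewrite e' eqxx in bx.
have FE x y : x != y -> F (ev x y) = ev (g x) (g y).
  by move=> xy; apply: ev_of_pts; [rewrite (inj_eq gi)|exact: gx|exact: gy].
have gs v : exists x, g x = v.
  have [v' vv' _] := exists_neq2 v v; have [e E] := surj (ev v v').
  have [z [u [zu eE]]] := event_pair e.
  have : pts (F e) v by rewrite E pts_ev 1?eq_sym//; left.
  by rewrite eE FE// pts_ev ?(inj_eq gi)// => -[] ->; [exists z|exists u].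
have [g' g'K] := choice gs.
exists g; first by exists g' => // x; apply: gi; rewrite g'K.
apply/funext => e; have [x [y [xy ->]]] := event_pair e.
by rewrite FE// event_map_ev.
Qed.

End EventMap.

(** * The automorphism groups *)

Section Automorphisms.
Variable R : realType.
Implicit Types x y z u v p q w : S1 R.
Implicit Types e a : event R.
Implicit Types f g : S1 R -> S1 R.

Lemma uniq_inj g x y z u : injective g ->
  uniq [:: g x; g y; g z; g u] = uniq [:: x; y; z; u].
Proof. by move=> gi; rewrite !uniq4 !(inj_eq gi). Qed.

Lemma moebius_autP (M : moebius R) d g : M d -> moebius_aut M g <->
  bijective g /\ forall x y z u, uniq [:: x; y; z; u] ->
    lcr d (g x) (g y) (g z) (g u) = lcr d x y z u.
Proof.
move=> Md; split=> [[gb gM]|[gb gd]]; split => //.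
  move=> x y z u U; have V : uniq [:: g x; g y; g z; g u].
    by rewrite uniq_inj//; exact: bij_inj.
  exact/(cross_ratio_lcr d d V U)/gM.
move=> d' x y z u Md' U; have V : uniq [:: g x; g y; g z; g u].
  by rewrite uniq_inj//; exact: bij_inj.
have e : moebius_equiv d d' by have ME := moebius_ofP Md; rewrite ME in Md'.
by rewrite -(e _ _ _ _ U) -(e _ _ _ _ V); apply/(cross_ratio_lcr d d V U)/gd.
Qed.

Lemma moebius_aut_group (M : moebius R) : transformation_group (moebius_aut M).
Proof.
split.
- by split => //; exists id.
- move=> f g [fb fM] [gb gM]; split; first exact: bij_comp.
  move=> d x y z u Md U; have V : uniq [:: g x; g y; g z; g u].
    by rewrite uniq_inj//; exact: bij_inj.
  by rewrite /= fM// gM.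
- move=> f [fb fM]; have fi := bij_inj fb; have [g fK gK] := fb.
  exists g; split => //; split; first by exists f.
  move=> d x y z u Md U; have V : uniq [:: g x; g y; g z; g u].
    by rewrite uniq_inj//; exact: can_inj gK.
  by rewrite -(fM d (g x) (g y) (g z) (g u))// !gK.
Qed.

Variables (M : moebius R) (T : timed_causal_space R) (d : semimetric R).
Hypotheses (Md : M d) (hd : log_moebius (ld d)) (MT : is_That M T).

Let lineE : line_of T = sm_line d := let: And3 e _ _ := MT Md in e.
Let linesE : lines T = range (sm_line d) := let: And3 _ e _ := MT Md in e.
Let timeE : forall a a' s, time T a a' = Some s <-> sm_time d a a' s :=
  let: And3 _ _ e := MT Md in e.

Lemma sm_line_lcr x y z u : uniq [:: x; y; z; u] ->
  sm_line d (ev x y) (ev z u) <-> lcr d x y z u = 0.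
Proof.
rewrite uniq4 => U; have /and5P[xy xz xu yz /andP[yu zu]] := U.
split=> [/(sm_line_ev hd xy zu)[_]|]; first by rewrite /harm /lr /lcr; lra.
move=> E; have h : harm (ld d) x y z u by move: E; rewrite /harm /lr /lcr; lra.
by apply/(sm_line_ev hd xy zu); split => //; exact: (harm_sep hd U h).
Qed.

Lemma line_dist_lcr x y z u : line_dist d x y z u = `|lcr d x y z u|.
Proof. by rewrite /line_dist -normrN; congr `|_|; rewrite /lr /lcr; lra. Qed.

Lemma tcs_aut_event_map g : moebius_aut M g -> tcs_aut T (event_map g).
Proof.
move=> /(moebius_autP _ Md)[gb gd]; have gi := bij_inj gb.
have gneq x y : x != y -> g x != g y by rewrite (inj_eq gi).
have gline x y z u : x != y -> z != u -> sm_line d (ev x y) (ev z u) <->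
    sm_line d (ev (g x) (g y)) (ev (g z) (g u)).
  move=> xy zu; have UE := uniq_inj x y z u gi.
  have toU v w p q : v != w -> p != q -> sm_line d (ev v w) (ev p q) -> uniq [:: v; w; p; q].
    by move=> vw pq /(sm_line_ev hd vw pq)[/sep_uniq]; rewrite uniq4.
  split=> l.
    have U := toU _ _ _ _ xy zu l; have V := U; rewrite -UE in V.
    by apply/(sm_line_lcr V); rewrite gd//; apply/(sm_line_lcr U).
  have V := toU _ _ _ _ (gneq _ _ xy) (gneq _ _ zu) l; have U := V; rewrite UE in U.
  by apply/(sm_line_lcr U); rewrite -gd//; apply/(sm_line_lcr V).
split.
- exact: event_map_bij.
- move=> l; rewrite linesE => -[e _ <-].
  have [x [y [xy ->]]] := event_pair e; exists (ev (g x) (g y)) => //.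
  apply/seteqP; split => [a|_ [a k <-]].
    have [z' [u' [zu' ->]]] := event_pair a.
    have [g' g'K gK] := gb; rewrite -(gK z') -(gK u') => k.
    have zu : g' z' != g' u' by rewrite (inj_eq (can_inj gK)).
    exists (ev (g' z') (g' u')); first by apply/gline.
    by rewrite event_map_ev.
  have [z [u [zu aE]]] := event_pair a; rewrite aE in k *.
  by rewrite event_map_ev//; exact: (iffLR (gline _ _ _ _ xy zu) k).
- move=> e e' s /timeE st; apply/timeE.
  have [z [u [zu eE]]] := event_pair e; have [z' [u' [zu' eE']]] := event_pair e'.
  have [l|l] := pselect (on_light_line e e').
    left; split; last by case: st => [[]|[[_ []]]].
    move: l; rewrite eE eE' !event_map_ev// !on_light_lineE !pts_ev ?gneq//.
    by case=> p [h h']; exists (g p); split; [case: h|case: h'] => ->; [left|right|left|right].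
  have sc : strong_causal e e' by split => //; exact: sm_time_causal st.
  move: st; have [x [y [p [q [p' [q' [[xy pq pq'] -> -> [k k' _ _]]]]]]]] :=
    strong_causal_line hd sc.
  move=> /(sm_time_line hd _ xy pq pq' k k') ->; rewrite !event_map_ev//.
  have gk := iffLR (gline _ _ _ _ xy pq) k; have gk' := iffLR (gline _ _ _ _ xy pq') k'.
  apply/(sm_time_line hd _ (gneq _ _ xy) (gneq _ _ pq) (gneq _ _ pq') gk gk').
  have [->|pp'] := eqVneq p p'; first by rewrite /line_dist !subrr.
  have [/sep_uniq/and5P[_ xp _ yp _] _] := iffLR (sm_line_ev hd xy pq) k.
  have [/sep_uniq/and5P[_ xp' _ yp' _] _] := iffLR (sm_line_ev hd xy pq') k'.
  by rewrite !line_dist_lcr gd// uniq4 xy xp xp' yp yp' pp'.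
Qed.

Lemma tcs_aut_surj F : tcs_aut T F -> exists2 g, moebius_aut M g & F = event_map g.
Proof.
move=> [Fb Fl Ft]; have hT := line_ofP T.
have [e e' l|g gb FE] := event_map_surj Fb.
  by apply/(tc_t2 hT)/Ft/(tc_t2 hT).
exists g => //; apply/(moebius_autP _ Md); split => //; have gi := bij_inj gb.
have gneq x y : x != y -> g x != g y by rewrite (inj_eq gi).
have [g' g'K gK] := gb.
have Fev x y : x != y -> F (ev x y) = ev (g x) (g y) by move=> xy; rewrite FE event_map_ev.
(* The image is the line of some event [e'], and the points of [e'] are recognised as those on no
   event of that line. *)
have Fline x y : x != y -> F @` sm_line d (ev x y) = sm_line d (ev (g x) (g y)).
  move=> xy; have : range (sm_line d) (F @` sm_line d (ev x y)).
    by rewrite -linesE; apply: Fl; rewrite linesE; exists (ev x y).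
  move=> [e' _ E]; rewrite -E; congr sm_line; apply: event_ext.
  rewrite (pts_off_line e' hT) lineE E pts_ev ?gneq//.
  have off := pts_off_line (ev x y) hT; rewrite lineE in off.
  have FP a q : pts (F a) q <-> pts a (g' q).
    have [z [u [zu ->]]] := event_pair a; rewrite Fev// !pts_ev ?gneq//.
    by split=> -[e|e]; [left|right|left|right]; rewrite /= -?e ?gK// e g'K.
  apply/seteqP; split=> q /=.
    move=> nq; have : pts (ev x y) (g' q).
      rewrite off /= => -[a [ka aq]]; apply: nq; exists (F a).
      by split; [exists a|apply/FP].
    by rewrite pts_ev// => -[] e; [left|right]; rewrite /= -e gK.
  move=> qE [_ [[a ka <-] /FP aq]].
  have : pts (ev x y) (g' q) by rewrite pts_ev//; case: qE => ->; rewrite g'K; [left|right].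
  by rewrite off /= => -[]; exists a.
(* The absolute value of [lcr] is the time between the events of the line of [(x, y)] through [z]
   and [u], whose images lie on the line of [(g x, g y)]. *)
have absE x y z u : uniq [:: x; y; z; u] ->
    `|lcr d (g x) (g y) (g z) (g u)| = `|lcr d x y z u|.
  rewrite uniq4 => /and5P[xy xz xu yz /andP[yu zu]].
  have [z' s k] := harm_ex hd xy xz yz; have [u' s' k'] := harm_ex hd xy xu yu.
  have /and5P[_ _ _ _ /andP[_ zz']] := sep_uniq s.
  have /and5P[_ _ _ _ /andP[_ uu']] := sep_uniq s'.
  have l := in_sm_line hd s k; have l' := in_sm_line hd s' k'.
  have : time T (ev z z') (ev u u') = Some (line_dist d x y z u).
    by apply/timeE/(sm_time_line hd _ xy zz' uu' l l').
  move=> /Ft/timeE; rewrite !Fev// => st.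
  have Gl : sm_line d (ev (g x) (g y)) (ev (g z) (g z'))
    by rewrite -Fline// -Fev//; exists (ev z z').
  have Gl' : sm_line d (ev (g x) (g y)) (ev (g u) (g u'))
    by rewrite -Fline// -Fev//; exists (ev u u').
  have := iffLR (sm_time_line hd _ (gneq _ _ xy) (gneq _ _ zz') (gneq _ _ uu') Gl Gl') st.
  by rewrite !line_dist_lcr.
(* Non-separation means that the time is defined, which [F] preserves. *)
have gsep x y z u : x != y -> z != u -> ~~ sep x y z u -> ~~ sep (g x) (g y) (g z) (g u).
  move=> xy zu /(causal_ev xy zu)/(tc_t1_def hT)[s /Ft E].
  apply/(causal_ev (gneq _ _ xy) (gneq _ _ zu))/(tc_t1_def hT); exists s.
  by rewrite -!Fev.
(* The images are again in cyclic order, up to reversal, and [lcr] is positive for either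
   orientation; so its sign is preserved as well. *)
have posE x y z u : cyc4 x y z u -> lcr d (g x) (g y) (g z) (g u) = lcr d x y z u.
  move=> k; have U := cyc4_neq k; have V := U; rewrite -uniq4 in V.
  have /and5P[xy xz xu yz /andP[yu zu]] := U.
  have [m1 m2] := cyc4_nonsep k.
  have n1 : ~~ sep (g x) (g y) (g z) (g u) by exact: gsep.
  have n2 : ~~ sep (g x) (g u) (g y) (g z) by exact: gsep.
  have W : uniq [:: g x; g y; g z; g u] by rewrite uniq_inj.
  have gk := nonsep_cyc4 W n1 n2.
  have pos p q v w : cyc4 p q v w -> 0 < lcr d p q v w.
    rewrite cyc4_rot => /(lm_mono hd).
    by rewrite /lcr (ld_sym d v p) (ld_sym d w p); lra.
  have gpos : 0 < lcr d (g x) (g y) (g z) (g u).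
    case/orP: gk => /pos //; rewrite /lcr.
    rewrite (ld_sym d (g u) (g y)) (ld_sym d (g z) (g x)).
    by rewrite (ld_sym d (g u) (g x)) (ld_sym d (g z) (g y)); lra.
  by have := absE _ _ _ _ V; rewrite !gtr0_norm// pos.
move=> x y z u U; rewrite /lcr.
apply: (@cross_difference_eq _ (fun x y => ld d (g x) (g y)) (ld d)) => //.
- by move=> p q; exact: ld_sym.
- by move=> p q; exact: ld_sym.
- by move=> p q v w /posE; rewrite /lcr; lra.
Qed.

Lemma tcs_aut_group : transformation_group (tcs_aut T).
Proof.
split.
- split; [by exists id| |by []].
  by move=> l; rewrite image_id.
- move=> f g [fb fl ft] [gb gl gt]; split; first exact: bij_comp.
    by move=> l /gl/fl; rewrite image_comp.
  by move=> e e' s /gt/ft.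
(* The conditions on [F] go in one direction only; its inverse satisfies them because it is induced
   by the inverse Möbius automorphism. *)
- move=> F FA; have [g gA FE] := tcs_aut_surj FA.
  have [_ _ /(_ _ gA)[g' [gA' gK g'K]]] := moebius_aut_group M.
  exists (event_map g'); split; first exact: tcs_aut_event_map.
    move=> e; rewrite FE -[LHS]/((event_map g' \o event_map g) e) -event_map_comp.
    - by rewrite (_ : g' \o g = id) ?event_map_id//; apply/funext => x /=; rewrite gK.
    - exact: can_inj g'K.
    - exact: can_inj gK.
  move=> e; rewrite FE -[LHS]/((event_map g \o event_map g') e) -event_map_comp.
  - by rewrite (_ : g \o g' = id) ?event_map_id//; apply/funext => x /=; rewrite g'K.
  - exact: can_inj gK.
  - exact: can_inj g'K.
Qed.

End Automorphisms.

Theorem theorem1p1 (R : realType) :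
  exists (That : monotone_moebius R -> timed_causal_space R)
         (Mhat : timed_causal_space R -> monotone_moebius R),
  [/\ (forall M : monotone_moebius R, is_That M (That M)),
      (forall T : timed_causal_space R,
         is_Mhat T (Mhat T) /\
         forall M : moebius R, is_Mhat T M -> M = Mhat T :> moebius R),
      (cancel That Mhat /\ cancel Mhat That) &
      (forall M : monotone_moebius R,
         let AutM := moebius_aut M in
         let AutT := tcs_aut (That M) in
         [/\ transformation_group AutM,
             transformation_group AutT,
             set_bij AutM AutT (@event_map R) &
             forall f g, AutM f -> AutM g ->
               event_map (f \o g) = event_map f \o event_map g])].
Proof.
have [That hThat] := choice (@That_ex R); have [Mhat hMhat] := choice (@Mhat_ex R).
exists That, Mhat; split => //.
- by move=> T; split => // M /is_Mhat_uniq; apply.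
- split=> [M|T].
    apply: mm_eq; apply: (is_Mhat_uniq (hMhat _)).
    exact: is_That_Mhat (mm_monotone M) (hThat M).
  exact: is_That_uniq (hThat _) (is_Mhat_That (hMhat T)).
move=> M AutM AutT; have [d Md] := moebius_ex M.
have hd := monotone_log_moebius (mm_monotone M) Md.
have inj f : AutM f -> injective f by case=> /bij_inj.
split.
- exact: moebius_aut_group.
- exact: tcs_aut_group Md hd (hThat M).
- split.
  + by move=> f; exact: tcs_aut_event_map Md hd (hThat M) f.
  + by move=> f g /set_mem/inj fi /set_mem/inj gi; exact: event_map_inj.
  + by move=> F /(tcs_aut_surj Md hd (hThat M))[g gA ->]; exists g.
- by move=> f g /inj fi /inj gi; exact: event_map_comp.
Qed.
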